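(* The output of the algorithm LowerVeeringPolynomial (described in the context) applied to a (transverse taut) veering triangulation $\mathcal{V}=((T,F,E),\alpha,\nu)$ of a 3-manifold $M$ is equal to the lower veering polynomial $V^L_{\mathcal{V}}$ of $\mathcal{V}$ (as elements of $\mathbb{Z}[H]\cong\mathbb{Z}[u_1^{\pm1},\dots,u_r^{\pm1}]$).
   Context: $M$ is a compact, oriented, connected 3-manifold with a finite positive number of toroidal boundary components (viewed as cusps), with an ideal triangulation $\mathcal{T}=(T,F,E)$: $T,F,E$ are the sets of ideal tetrahedra, triangles and edges, with $|T|=|E|=n$, $|F|=2n$. Triangles/tetrahedra attached to an edge are counted with embeddings. Transverse taut: a coorientation $\alpha$ is given on every triangle such that for each tetrahedron $t$ two faces (top faces) are cooriented out of $t$ and two (bottom faces) into $t$; $t$ is immediately below its top faces and immediately above its bottom faces. The top (bottom) diagonal of $t$ is the common edge of its two top (bottom) faces; the other four edges are equatorial. Assign angle $\pi$ to the diagonals and $0$ to the equatorial edges; for each $e\in E$ the angles over all embeddings of $e$ into tetrahedra must sum to $2\pi$. So each $e$ is the top diagonal of one tetrahedron (immediately below $e$) and the bottom diagonal of one (immediately above $e$), and the triangles attached to $e$ form two sides (left and right), each ordered from bottom to top by the coorientation. Veering: a transverse taut triangulation with a colouring $\nu$ of the edges red/blue such that in each tetrahedron, viewed from above (coorientation towards the viewer, using the orientation of $M$) and drawn with vertical top diagonal and horizontal bottom diagonal, the equatorial edges of positive slope are red and those of negative slope are blue. In a veering triangulation every edge has degree at least 4 and at least two triangles on each of its sides. Let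 $H=H_1(M;\mathbb{Z})/\text{torsion}$ (multiplicative), of rank $r$; $M^{ab}\to M$ the maximal free abelian cover with deck group $H$; $\mathcal{V}^{ab}$ the lifted triangulation. Fix a connected fundamental domain whose closure is triangulated by one lift $1\cdot t$ of each $t\in T$; other tetrahedra are $h\cdot t$. Triangles and edges inherit their $H$-coefficient from the tetrahedron immediately below them. Lower veering polynomial: let $N^L:\mathbb{Z}[H]^T\to\mathbb{Z}[H]^E$ be the $\mathbb{Z}[H]$-homomorphism with $N^L(1\cdot t)=d_t-d_b-s_1-s_2$, where $d_t,d_b$ are the top and bottom diagonals of $1\cdot t$ and $s_1,s_2$ its two equatorial edges of a colour different from $d_b$. Identify $\mathbb{Z}[H]^T$ with $\mathbb{Z}[H]^E$ by identifying each tetrahedron of $\mathcal{V}^{ab}$ with its top diagonal; then $V^L_{\mathcal{V}}$ is the determinant of $N^L$ as an endomorphism of $\mathbb{Z}[H]^E$ (so it is well-defined as an element of $\mathbb{Z}[H]$, not just up to a unit). Dual graph $X$: vertex for each $t\in T$; for each $f\in F$ an edge, oriented upwards (from the tetrahedron immediately below $f$ to the one immediately above). Subroutine FacePairings (with empty list of extra cycles). Let $B:\mathbb{Z}^E\to\mathbb{Z}^F$ be the branch equations matrix ($2n\times n$): $B(e)=(f_1+\dots+f_k)-(f'_1+\dots+f'_{d-k})$, where $f_1,\dots,f_k$ are the triangles attached to $e$ on its right and $f'_1,\dots,f'_{d-k}$ those on its left. Choose a spanning tree $Y$ of $X$ and delete from $B$ the rows of triangles dual to edges of $Y$, giving $B_Y$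 of size $(n+1)\times n$. Compute a Smith normal form $S=UB_YV$ with $U,V$ invertible over $\mathbb{Z}$ and the zero rows of $S$ last; the number of zero rows is $r$. The output is the tuple of face Laurents $\Lambda(f)$: $\Lambda(f)=1$ if $f$ is dual to an edge of $Y$, and otherwise $\Lambda(f)=u^{v}=u_1^{v_1}\cdots u_r^{v_r}$, where $v\in\mathbb{Z}^r$ consists of the last $r$ entries of the column of $U$ indexed by $f$. Here $H$ is identified with the Laurent monomials in $u_1,\dots,u_r$ through the basis of $H$ given by the last $r$ columns of $U^{-1}$, viewed as 1-cycles in $X/Y$. Algorithm LowerVeeringPolynomial. Input: $\mathcal{V}$. (1) Order $T$ and $E$ so that $E[i]$ is the top diagonal of $T[i]$ for each $i$. (2) Compute the face Laurents $\Lambda$ by FacePairings. (3) Let $N$ be the zero matrix with rows indexed by $E$ and columns by $T$. For each $e\in E$, let $L$ and $R$ be the lists of triangles attached to $e$ on the left and on the right, ordered from bottom to top, and do the following. Add $1$ to the entry $(e,t)$ of $N$, where $t$ is the tetrahedron immediately below $L[1]$. Subtract $\prod_{i=1}^{\mathrm{length}(L)}\Lambda(L[i])^{-1}$ from the entry $(e,t')$ of $N$, where $t'$ is the tetrahedron immediately above the last triangle of $L$. For each $A\in\{L,R\}$ and each $i$ with $1<i\le \mathrm{length}(A)-1$, subtract $\prod_{j=1}^{i}\Lambda(A[j])^{-1}$ from the entry $(e,t'')$ of $N$, where $t''$ is the tetrahedron immediately above $A[i]$. (4) Return $\det N$. *)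

(* Defs.v *)
From HB Require Import structures.
From Stdlib Require Import Relation_Operators.
From mathcomp Require Import all_boot all_order all_fingroup all_algebra.
From mathcomp Require Import ring_quotient generic_quotient finmap.
From mathcomp Require Import boolp classical_sets.
From mathcomp Require Import monalg.

Set Implicit Arguments.
Unset Strict Implicit.
Unset Printing Implicit Defensive.

Import GRing.Theory.
Local Open Scope ring_scope.

(* ------------------------------------------------------------------ *)
(* The integral group ring Z[H] of an abelian group H written           *)
(* additively.  The library puts a ring structure on {malg R[K]} only   *)
(* for monoids K without nontrivial units, so the convolution product   *)
(* is set up here on the free Z-module {malg int[H]}.  For              *)
(* H = 'rV[int]_r this is the ring of Laurent polynomials in            *)
(* u_1, ..., u_r, and mon v is the monomial u^v.                        *)

Definition gring (H : zmodType) : Type := {malg int[H]}.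

Section GroupRing.
Variable H : zmodType.
Implicit Types (g : {malg int[H]}) (h k : H).

HB.instance Definition _ := GRing.Zmodule.on (gring H).

Definition gmul (g1 g2 : gring H) : gring H :=
  \sum_(k1 <- msupp g1) \sum_(k2 <- msupp g2)
    mkmalgU (k1 + k2)%R (g1@_k1 * g2@_k2).

Definition mon (h : H) : gring H := mkmalgU h 1.

Lemma gmulw (d1 d2 : {fset H}) g1 g2 :
  (msupp g1 `<=` d1)%fset -> (msupp g2 `<=` d2)%fset ->
  gmul g1 g2 = \sum_(k1 <- d1) \sum_(k2 <- d2)
    mkmalgU (k1 + k2)%R (g1@_k1 * g2@_k2).
Proof.
move=> le_d1 le_d2; rewrite /gmul (big_fset_incl _ le_d1) /=.
  apply/eq_bigr=> k1 _; apply/big_fset_incl => // k _ /mcoeff_outdom ->.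
  by rewrite mulr0 monalgU0.
move=> k _ /mcoeff_outdom g1k.
by rewrite big1 => // k' _; rewrite g1k mul0r monalgU0.
Qed.

Lemma gmulC : commutative gmul.
Proof.
move=> g1 g2; rewrite /gmul exchange_big /=.
apply: eq_bigr => k2 _; apply: eq_bigr => k1 _.
by rewrite addrC mulrC.
Qed.

Lemma gmulDl : left_distributive gmul +%R.
Proof.
move=> g1 g2 g.
rewrite (gmulw (fsubsetUl (msupp g1) (msupp g2)) (fsubset_refl (msupp g))).
rewrite (gmulw (fsubsetUr (msupp g1) (msupp g2)) (fsubset_refl (msupp g))).
rewrite (gmulw (msuppD_le g1 g2) (fsubset_refl (msupp g))).
rewrite -big_split /=; apply/eq_bigr=> k1 _.
rewrite -big_split /=; apply/eq_bigr=> k2 _.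
by rewrite mcoeffD mulrDl monalgUD.
Qed.

Lemma gmulDr : right_distributive gmul +%R.
Proof. by move=> g g1 g2; rewrite gmulC gmulDl !(gmulC _ g). Qed.

Lemma gmul0g : left_zero 0 gmul.
Proof. by move=> g; rewrite /gmul msupp0 big_seq_fset0. Qed.

Lemma gmulg0 : right_zero 0 gmul.
Proof. by move=> g; rewrite gmulC gmul0g. Qed.

Lemma gmulUU c1 c2 k1 k2 :
  gmul (mkmalgU k1 c1) (mkmalgU k2 c2) = mkmalgU (k1 + k2)%R (c1 * c2).
Proof. by rewrite (gmulw msuppU_le msuppU_le) !big_seq_fset1 !mcoeffUU. Qed.

Lemma gmulE1 g1 g2 :
  gmul g1 g2 = \sum_(k1 <- msupp g1) gmul (mkmalgU k1 g1@_k1) g2.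
Proof.
apply/eq_bigr=> k _; rewrite (gmulw msuppU_le (fsubset_refl _)) big_seq_fset1.
by apply/eq_bigr => k' _; rewrite mcoeffUU.
Qed.

Lemma gmulE2 g1 g2 :
  gmul g1 g2 = \sum_(k2 <- msupp g2) gmul g1 (mkmalgU k2 g2@_k2).
Proof. by rewrite gmulC gmulE1; apply/eq_bigr=> k _; rewrite gmulC. Qed.

Lemma gmul1g : left_id (mon 0) gmul.
Proof.
move=> g; rewrite gmulE2 [RHS]monalgE.
by apply/eq_bigr=> k _; rewrite gmulUU add0r mul1r.
Qed.

Lemma gmulA : associative gmul.
Proof.
move=> g1 g2 g3.
rewrite [RHS](big_morph (gmul^~ _) (fun _ _ => gmulDl _ _ _) (gmul0g _)).
rewrite gmulE1; apply/eq_bigr=> k1 _.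
rewrite [LHS](big_morph (gmul _) (fun _ _ => gmulDr _ _ _) (gmulg0 _)).
rewrite [RHS](big_morph (gmul^~ _) (fun _ _ => gmulDl _ _ _) (gmul0g _)).
apply/eq_bigr=> k2 _.
rewrite [LHS](big_morph (gmul _) (fun _ _ => gmulDr _ _ _) (gmulg0 _)).
by rewrite gmulE2; apply/eq_bigr=> k3 _; rewrite !gmulUU mulrA addrA.
Qed.

Lemma mon_neq0 : mon 0 != 0.
Proof. by rewrite monalgU_eq0. Qed.

HB.instance Definition _ := GRing.Zmodule_isComNzRing.Build (gring H)
  gmulA gmulC gmul1g gmulDl mon_neq0.

End GroupRing.

(* The ring homomorphism Z[G] -> Z[H] induced by theta : G -> H.        *)
Definition gring_map (G H : zmodType) (theta : G -> H) (x : gring G) :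
    gring H :=
  \sum_(k <- msupp (x : {malg int[G]})) mon (theta k) *~ mcoeff k x.

(* ------------------------------------------------------------------ *)
(* Ideal triangulations.  The vertices of every tetrahedron are         *)
(* labelled by 'I_4, the labels 0,1,2,3 being in positive order, that   *)
(* is, (v1 - v0, v2 - v0, v3 - v0) is a positive frame.  Face i of a    *)
(* tetrahedron is the face opposite to vertex i.  Face i of t is glued  *)
(* to a face of nbr t i by v |-> glu t i v (v != i); glu t i i is the   *)
(* number of that face of nbr t i.                                      *)
(* The carrier T is not assumed to be finite, so that covers are also   *)
(* of this form.                                                        *)

Record gluing (T : Type) := Gluing {
  nbr : T -> 'I_4 -> T;
  glu : T -> 'I_4 -> {perm 'I_4}
}.

Definition v0 : 'I_4 := @Ordinal 4 0 isT.
Definition v1 : 'I_4 := @Ordinal 4 1 isT.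
Definition v2 : 'I_4 := @Ordinal 4 2 isT.
Definition v3 : 'I_4 := @Ordinal 4 3 isT.

Definition medge := {A : {set 'I_4} | #|A| == 2}.

Fact mimg_subproof (s : {perm 'I_4}) (A : medge) : #|s @: val A| == 2.
Proof. by rewrite card_imset ?(valP A) //; exact: perm_inj. Qed.
Definition mimg (s : {perm 'I_4}) (A : medge) : medge :=
  exist _ (s @: val A) (mimg_subproof s A).

(* The edge A of t, seen in the tetrahedron glued to face i of t; this  *)
(* makes sense when i is not an endpoint of A.                          *)
Definition edge_across (T : Type) (G : gluing T) (i : 'I_4) (x : T * medge) :
    T * medge := (nbr G x.1 i, mimg (glu G x.1 i) x.2).

(* (t, A) and (t', A') are identified in the glued-up space.            *)
Definition same_edge (T : Type) (G : gluing T) : T * medge -> T * medge -> Prop :=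
  clos_refl_trans _ (fun x y : T * medge =>
    exists2 i, i \notin val x.2 & y = edge_across G i x).

(* A flag (t, p) stands for the vertex p 0, the edge from p 0 to p 1    *)
(* and the face {p 0, p 1, p 2} of t; that face is face p 3.            *)
Definition flag (T : Type) : Type := (T * {perm 'I_4})%type.
HB.instance Definition _ (T : finType) := Finite.on (flag T).

Section Flags.
Variables (T : Type) (G : gluing T).

Definition swap (i j : 'I_4) (x : flag T) : flag T :=
  (x.1, (tperm i j * x.2)%g).

(* Pass through the face of a flag. *)
Definition cross (x : flag T) : flag T :=
  (nbr G x.1 (x.2 v3), (x.2 * glu G x.1 (x.2 v3))%g).

(* Turn about the edge of a flag: pass through its face, then move on   *)
(* to the other face of the new tetrahedron containing the edge.        *)
Definition turn (x : flag T) : flag T := swap v2 v3 (cross x).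

Fact fedge_subproof (p : {perm 'I_4}) : #|[set p v0; p v1]| == 2.
Proof. by rewrite cards2 (inj_eq perm_inj). Qed.
Definition fedge (x : flag T) : medge :=
  exist _ [set x.2 v0; x.2 v1] (fedge_subproof x.2).

End Flags.

Definition moves (T : finType) (ms : seq (flag T -> flag T)) : rel (flag T) :=
  [rel x y | has (fun m => m x == y) ms].

(* The space obtained from the gluing and with the vertices removed is  *)
(* the interior of a compact, oriented, connected 3-manifold with       *)
(* toroidal boundary.  Orientability already makes the space a manifold *)
(* along its edges.  The flags at an ideal vertex form an orbit cusp of *)
(* the moves fixing the vertex; the vertices, edges and triangles of    *)
(* its link are the orbits in cusp of the moves fixing an edge end, a   *)
(* corner of a face and a corner of a tetrahedron, respectively.  The   *)
(* link is closed, connected and orientable, and tri_torus says that    *)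
(* its Euler characteristic is 0.                                       *)
Record triangulation := Triangulation {
  tet : finType;
  tri :> gluing tet;
  tri_glueK : forall t i,
    nbr tri (nbr tri t i) (glu tri t i i) = t /\
    glu tri (nbr tri t i) (glu tri t i i) = (glu tri t i)^-1%g;
  tri_unfolded : forall t i, (nbr tri t i, glu tri t i i) != (t, i);
  tri_oriented : forall t i, odd_perm (glu tri t i);
  tri_nonempty : (0 < #|tet|)%N;
  tri_connected : forall t t',
    connect [rel u u' | [exists i, nbr tri u i == u']] t t';
  tri_torus : forall x : flag tet,
    let cusp :=
      connect (moves [:: swap v1 v2; swap v2 v3; cross tri]) x in
    let link_vertices := moves [:: swap v2 v3; cross tri] in
    let link_edges := moves [:: swap v1 v2; cross tri] in
    let link_triangles := moves [:: @swap tet v1 v2; swap v2 v3] in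
    (n_comp link_vertices cusp + n_comp link_triangles cusp
       = n_comp link_edges cusp)%N
}.

Section Edges.
Variable M : triangulation.

Definition edge_step : rel (tet M * medge) :=
  [rel x y : tet M * medge | [exists i, (i \notin val x.2) && (y == edge_across M i x)]].

Definition edge_class (x : tet M * medge) : {set tet M * medge} :=
  [set y | connect edge_step x y].

Definition edge := {e : {set tet M * medge} | e \in codom edge_class}.

Definition edge_of (x : tet M * medge) : edge :=
  exist _ (edge_class x) (codom_f edge_class x).

End Edges.

(* Transverse taut triangulations.  The coorientation is given by:      *)
(* outward t i says that face i of t is cooriented out of t.            *)
Record coorientation (M : triangulation) := Coorientation {
  outward : tet M -> 'I_4 -> bool;
  outward_glue : forall t i,
    outward (nbr M t i) (glu M t i i) = ~~ outward t i;
  outward_two : forall t, #|[set i | outward t i]| == 2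
}.

Section Taut.
Variables (M : triangulation) (al : coorientation M).
Local Notation T := (tet M).

(* The common edge of two faces joins the vertices opposite to the      *)
(* other two faces.                                                     *)
Fact top_diag_subproof t : #|[set i | ~~ outward al t i]| == 2.
Proof.
have -> : [set i | ~~ outward al t i] = ~: [set i | outward al t i].
  by apply/setP => i; rewrite !inE.
by rewrite cardsCs finset.setCK card_ord (eqP (outward_two al t)).
Qed.
Definition top_diag (t : T) : medge :=
  exist _ [set i | ~~ outward al t i] (top_diag_subproof t).
Definition bot_diag (t : T) : medge :=
  exist _ [set i | outward al t i] (outward_two al t).

(* Dihedral angles in units of pi. *)
Definition angle (x : T * medge) : nat :=
  (x.2 == top_diag x.1) || (x.2 == bot_diag x.1).

Definition taut : Prop :=
  forall e : edge M, (\sum_(x | edge_of x == e) angle x)%N = 2.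

(* A triangle is recorded by its side on the tetrahedron immediately    *)
(* below it.                                                            *)
Definition face := {x : T * 'I_4 | outward al x.1 x.2}.

Definition side_below (x : T * 'I_4) : T * 'I_4 :=
  if outward al x.1 x.2 then x else (nbr M x.1 x.2, glu M x.1 x.2 x.2).
Fact face_of_subproof x : outward al (side_below x).1 (side_below x).2.
Proof.
by rewrite /side_below; case: ifPn => //= h; rewrite outward_glue.
Qed.
Definition face_of (x : T * 'I_4) : face :=
  exist _ (side_below x) (face_of_subproof x).

Definition below (f : face) : T := (val f).1.
Definition above (f : face) : T := nbr M (val f).1 (val f).2.

(* ------------------------------------------------------------------ *)
(* Homology.  M deformation retracts onto the 2-complex dual to the     *)
(* triangulation, whose 1-skeleton is the dual graph X and whose        *)
(* 2-cells are attached along the loops around the edges.               *)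

Definition chain0 := {ffun T -> int}.
Definition chain1 := {ffun face -> int}.

Definition pt (t : T) : chain0 := [ffun u => (u == t)%:R].
Definition dual_edge (f : face) : chain1 := [ffun g => (g == f)%:R].

Definition bd (z : chain1) : chain0 :=
  \sum_f (pt (above f) - pt (below f)) *~ z f.

(* The oriented edge of X leaving t through its face i. *)
Definition step (t : T) (i : 'I_4) : chain1 :=
  if outward al t i then dual_edge (face_of (t, i)) else - dual_edge (face_of (t, i)).

(* The loop around the edge of x. *)
Definition loop (x : flag T) : chain1 :=
  \sum_(y <- fingraph.orbit (turn M) x) step y.1 (y.2 v3).

(* The 1-chains having a nonzero multiple that bounds. *)
Definition torsion : {pred chain1} := fun z =>
  `[< exists2 m : int, m != 0 &
      exists c : {ffun flag T -> int}, z *~ m = \sum_x loop x *~ c x >].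

Fact sum_mulz (I : finType) (V : zmodType) (F : I -> V) (m : int) :
  (\sum_i F i) *~ m = \sum_i F i *~ m.
Proof.
have h0 : (0 : V) *~ m = 0 by rewrite mul0rz.
have hD : {morph (fun u : V => u *~ m) : u v / u + v} by move=> u v; rewrite mulrzDl.
exact: (big_morph _ hD h0).
Qed.

Fact torsion_closed : zmod_closed torsion.
Proof.
split.
  apply/asboolP; exists 1 => //; exists 0; rewrite mul0rz big1 // => x _.
  by rewrite ffunE mulr0z.
move=> y z /asboolP [m m0 [c hc]] /asboolP [k k0 [d hd]]; apply/asboolP.
exists (m * k); first by rewrite mulf_neq0.
exists [ffun x => c x * k - d x * m].
rewrite mulrzBl mulrzA hc (mulrC m k) mulrzA hd !sum_mulz -sumrB.
by apply: eq_bigr => x _; rewrite ffunE mulrzBr !mulrzA.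
Qed.
HB.instance Definition _ := GRing.isZmodClosed.Build chain1 torsion torsion_closed.

Definition qchain := {ideal_quot torsion}.

Fact cross_involutive : involutive (cross M).
Proof.
move=> [t p]; rewrite /cross /=.
have [e1 e2] := tri_glueK t (p v3).
by rewrite !permM e1 e2 mulgK.
Qed.

Fact turn_inj : injective (turn M).
Proof.
move=> x y /(congr1 (swap v2 v3)); rewrite /turn.
have swapK : involutive (@swap T v2 v3).
  by move=> [t p]; rewrite /swap /= mulgA tperm2 mul1g.
by rewrite !swapK => /(can_inj cross_involutive).
Qed.

Fact bd_is_zmod_morphism : zmod_morphism bd.
Proof.
move=> y z; rewrite /bd -sumrB; apply: eq_bigr => f _.
by rewrite !ffunE mulrzBr.
Qed.
HB.instance Definition _ :=
  GRing.isZmodMorphism.Build chain1 chain0 bd bd_is_zmod_morphism.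

Fact bd_dual f : bd (dual_edge f) = pt (above f) - pt (below f).
Proof.
rewrite /bd (bigD1 f) //= ffunE eqxx mulr1z big1 ?addr0 // => g /negPf.
by rewrite ffunE => ->; rewrite mulr0z.
Qed.

Fact bd_step t i : bd (step t i) = pt (nbr M t i) - pt t.
Proof.
rewrite /step; case: (boolP (outward al t i)) => h.
  by rewrite bd_dual /above /below /= /side_below /= h.
rewrite raddfN /= bd_dual /above /below /= /side_below /= (negPf h) /= opprB.
by have [-> _] := tri_glueK t i.
Qed.

Fact bd_loop x : bd (loop x) = 0.
Proof.
rewrite /loop raddf_sum /=; under eq_bigr => y _.
  rewrite bd_step -/(turn M y).1; over.
rewrite sumrB !(big_uniq _ (orbit_uniq _ _)) /=; apply/eqP; rewrite subr_eq0.
apply/eqP; rewrite [RHS](reindex_inj turn_inj) /=; apply: eq_bigl => y.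
by rewrite -!fconnect_orbit same_fconnect1_r //; exact: turn_inj.
Qed.

Fact bd_torsion z : z \in torsion -> bd z = 0.
Proof.
case/asboolP => m m0 [c hc].
have : bd z *~ m = 0.
  rewrite -raddfMz hc raddf_sum big1 // => x _.
  by rewrite raddfMz /= bd_loop mul0rz.
move=> /ffunP h; apply/ffunP => t; move: (h t); rewrite ffunMzE !ffunE => /eqP.
by rewrite mulrzz mulf_eq0 (negPf m0) orbF => /eqP.
Qed.

(* The class of a 1-chain modulo torsion, and the boundary of a class. *)
Definition cls (z : chain1) : qchain := \pi_qchain%qT z.
Definition qbd (c : qchain) : chain0 := bd (repr c).

Fact cls_is_zmod_morphism : zmod_morphism cls.
Proof. by move=> y z; rewrite /cls raddfB. Qed.
HB.instance Definition _ :=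
  GRing.isZmodMorphism.Build chain1 qchain cls cls_is_zmod_morphism.

Fact qbd_cls z : qbd (cls z) = bd z.
Proof.
apply/eqP; rewrite /qbd -subr_eq0 -raddfB /= bd_torsion //.
by rewrite Quotient.idealrBE reprK.
Qed.

Fact qbd_is_zmod_morphism : zmod_morphism qbd.
Proof.
have clsK c : cls (repr c) = c by exact: reprK.
move=> c d; rewrite -[c]clsK -[d]clsK -raddfB !qbd_cls; exact: raddfB.
Qed.
HB.instance Definition _ :=
  GRing.isZmodMorphism.Build qchain chain0 qbd qbd_is_zmod_morphism.

Definition cycles : {pred qchain} := fun c => qbd c == 0.
Fact cycles_closed : zmod_closed cycles.
Proof.
split; first by rewrite unfold_in raddf0.
by move=> c d; rewrite !unfold_in => /eqP hc /eqP hd; rewrite raddfB /= hc hd subr0.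
Qed.
HB.instance Definition _ := GRing.isZmodClosed.Build qchain cycles cycles_closed.

(* H = H_1(M; Z) / torsion, written additively: 1-cycles modulo those   *)
(* having a nonzero multiple that bounds.                               *)
Record homology := Homology { hval : qchain; hvalP : hval \in cycles }.
HB.instance Definition _ := [isSub for hval].
HB.instance Definition _ := [Choice of homology by <:].
HB.instance Definition _ := [SubChoice_isSubZmodule of homology by <:].

(* ------------------------------------------------------------------ *)
(* The maximal free abelian cover.  Its tetrahedra over t are the       *)
(* classes in C_1 modulo torsion of the paths in X from a base          *)
(* tetrahedron t0 to t, i.e. the classes with boundary t - t0.          *)
Section Cover.
Variable t0 : T.

Record ab_tet := AbTet {
  abval :> T * qchain;
  abvalP : qbd abval.2 == pt abval.1 - pt t0
}.
HB.instance Definition _ := [isSub for abval].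
HB.instance Definition _ := [Choice of ab_tet by <:].

Fact ab_nbr_subproof (x : ab_tet) i :
  qbd (x.2 + cls (step x.1 i)) == pt (nbr M x.1 i) - pt t0.
Proof.
rewrite raddfD /= qbd_cls bd_step (eqP (abvalP x)).
by rewrite addrC -addrA addKr.
Qed.
Definition ab_nbr (x : ab_tet) (i : 'I_4) : ab_tet :=
  @AbTet (nbr M x.1 i, x.2 + cls (step x.1 i)) (ab_nbr_subproof x i).

Definition ab_cover : gluing ab_tet :=
  Gluing ab_nbr (fun x i => glu M x.1 i).

Fact deck_subproof (h : homology) (x : ab_tet) :
  qbd (x.2 + hval h) == pt x.1 - pt t0.
Proof. by rewrite raddfD /= (eqP (hvalP h)) addr0; exact: abvalP. Qed.
Definition deck (h : homology) (x : ab_tet) : ab_tet :=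
  @AbTet (x.1, x.2 + hval h) (deck_subproof h x).

(* A fundamental domain consisting of one lift 1.t of each tetrahedron  *)
(* t, connected through its triangles.                                  *)
Record fund_domain := FundDomain {
  dom_lift :> T -> ab_tet;
  dom_over : forall t, (dom_lift t).1 = t;
  dom_connected : forall t t',
    connect [rel u u' | [exists i, ab_nbr (dom_lift u) i == dom_lift u']] t t'
}.

End Cover.
End Taut.

(* ------------------------------------------------------------------ *)
(* Veering triangulations; the colour true is red.  Let p be an even    *)
(* labelling of t such that p 0 and p 1 are the endpoints of the top    *)
(* diagonal.  Seen from above with the top diagonal drawn vertically    *)
(* from p 0 = S up to p 1 = N, positivity of the labelling means that   *)
(* p 2 = E and p 3 = W: the edges SE and NW have positive slope and the *)
(* edges SW and NE have negative slope.                                 *)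
Record veering := Veering {
  vtri :> triangulation;
  vcoor : coorientation vtri;
  vtaut : taut vcoor;
  red : edge vtri -> bool;
  red_slope : forall (t : tet vtri) (p : {perm 'I_4}),
    ~~ odd_perm p -> fedge (t, p) = top_diag vcoor t ->
    let colour i j c := forall A : medge,
      val A = [set p i; p j] -> red (edge_of (t, A)) = c in
    [/\ colour v0 v2 true, colour v1 v3 true,
        colour v0 v3 false & colour v1 v2 false]
}.

(* ------------------------------------------------------------------ *)
Section LowerVeeringPolynomial.
Variable V : veering.
Local Notation T := (tet V).
Local Notation al := (vcoor V).
Local Notation H := (homology al).

Variables (t0 : T) (s : fund_domain al t0).

(* The element h such that the edge A of 1.t is h.e for an edge e of V, *)
(* that is, such that the tetrahedron immediately below this edge is    *)
(* h.t' for some t'.                                                    *)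
Definition edge_coef (t : T) (A : medge) : H :=
  xget 0 [set h : H | exists t' : T,
    same_edge (ab_cover al t0) (s t, A) (deck h (s t'), top_diag al t')]%classic.

(* The coefficient at e of the edge A of 1.t, as an element of Z[H]^E.  *)
Definition lift_edge (t : T) (A : medge) (e : edge V) : gring H :=
  if edge_of (t, A) == e then mon (edge_coef t A) else 0.

Definition lower_map (e : edge V) (t : T) : gring H :=
  let dt := top_diag al t in
  let db := bot_diag al t in
  lift_edge t dt e - lift_edge t db e
  - \sum_(A : medge | [&& A != dt, A != db
                        & red (edge_of (t, A)) != red (edge_of (t, db))])
      lift_edge t A e.

Definition lower_veering_polynomial : gring H :=
  \det (\matrix_(i < #|T|, j < #|T|)
    lower_map (edge_of (enum_val i, top_diag al (enum_val i))) (enum_val j)).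

End LowerVeeringPolynomial.

(* ------------------------------------------------------------------ *)
(* The algorithm.  Whatever it leaves open (what is left and right of   *)
(* an edge, orderings, the spanning tree, the Smith normal form) is a   *)
(* field of one of the records below.                                   *)

(* A choice of what is left and right of each edge: view e is the edge  *)
(* e as the top diagonal of the tetrahedron below it, with labels       *)
(* (S, N, E, W), so that the triangle of the flag view e is on the      *)
(* right of e.                                                          *)
Record edge_view (V : veering) := EdgeView {
  view :> edge V -> flag (tet V);
  view_even : forall e, ~~ odd_perm (view e).2;
  view_top : forall e, fedge (view e) = top_diag (vcoor V) (view e).1;
  view_edge : forall e, edge_of ((view e).1, fedge (view e)) = e
}.

Section Sides.
Variables (V : veering) (w : edge_view V).
Local Notation al := (vcoor V).

(* The triangles passed through when turning about the edge of x until  *)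
(* the tetrahedron having this edge as its bottom diagonal is reached.  *)
Definition side (x : flag (tet V)) : seq (face al) :=
  let around := fingraph.orbit (turn V) x in
  map (fun y : flag (tet V) => face_of al (y.1, y.2 v3))
    (take (find (fun y => fedge y == bot_diag al y.1) around) around).

Definition right_side (e : edge V) : seq (face al) := side (w e).
Definition left_side (e : edge V) : seq (face al) := side (swap v2 v3 (w e)).

Definition branch (f : face al) (e : edge V) : int :=
  (count_mem f (right_side e))%:Z - (count_mem f (left_side e))%:Z.

Definition spanning_tree (Y : {set face al}) : Prop :=
  (#|Y|.+1 = #|tet V|)%N /\
  forall t t', connect [rel u u' | [exists f in Y,
    ((below f == u) && (above f == u')) || ((below f == u') && (above f == u))]]
    t t'.

Record face_pairings := FacePairings {
  fp_tree : {set face al};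
  fp_treeP : spanning_tree fp_tree;
  (* the numbers of nonzero and of zero rows of the Smith normal form *)
  fp_nz : nat;
  fp_rk : nat;
  fp_row : 'I_(fp_nz + fp_rk) -> face al;
  fp_row_inj : injective fp_row;
  fp_rowP : forall f, (f \in codom fp_row) = (f \notin fp_tree);
  fp_col : 'I_#|{: edge V}| -> edge V;
  fp_col_bij : bijective fp_col;
  fp_U : 'M[int]_(fp_nz + fp_rk);
  fp_V : 'M[int]_#|{: edge V}|;
  fp_U_unit : fp_U \in unitmx;
  fp_V_unit : fp_V \in unitmx;
  fp_smith : let S := fp_U *m (\matrix_(k, j) branch (fp_row k) (fp_col j)) *m fp_V in
    (exists2 d : seq int, sorted dvdz d &
       S = \matrix_(i, j) (d`_i *+ (i == j :> nat))) /\
    (forall i, (row i S == 0) = (fp_nz <= i)%N)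
}.

Variable P : face_pairings.

(* The exponent of the face Laurent of f. *)
Definition laurent (f : face al) : 'rV[int]_(fp_rk P) :=
  if [pick k | fp_row k == f] is Some k
  then \row_j fp_U P (rshift (fp_nz P) j) k else 0.

(* The last fp_rk columns of the inverse of U, seen as classes of       *)
(* 1-cycles in X / Y: collapsing Y maps the cycles of X bijectively     *)
(* onto those of X / Y, by restriction to the complement of Y.          *)
Definition is_basis_class (j : 'I_(fp_rk P)) (h : homology al) : Prop :=
  exists z : chain1 al,
    [/\ bd z = 0, hval h = cls z &
        forall k, z (fp_row k) = invmx (fp_U P) k (rshift (fp_nz P) j)].

Local Notation LR := (gring 'rV[int]_(fp_rk P)).

(* mon (- v) is the inverse of the monomial u^v.                        *)
Definition inv_laurents (A : seq (face al)) : LR :=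
  \prod_(f <- A) mon (- laurent f).

(* Lists are indexed from 0 here.  The default value f0 is irrelevant,  *)
(* since the lists are not empty.                                       *)
Definition lvp_entry (e : edge V) (t : tet V) : LR :=
  let L := left_side e in
  let R := right_side e in
  let f0 := face_of al ((w e).1, (w e).2 v3) in
  (below (head f0 L) == t)%:R
  - (if above (last f0 L) == t then inv_laurents L else 0)
  - \sum_(A <- [:: L; R]) \sum_(1 <= i < (size A).-1)
      (if above (nth f0 A i) == t then inv_laurents (take i.+1 A) else 0).

End Sides.

Record lvp_run (V : veering) := LvpRun {
  run_view : edge_view V;
  run_T : 'I_#|tet V| -> tet V;
  run_E : 'I_#|tet V| -> edge V;
  run_T_bij : bijective run_T;
  run_E_bij : bijective run_E;
  run_top : forall i, run_E i = edge_of (run_T i, top_diag (vcoor V) (run_T i));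
  run_fp : face_pairings run_view
}.

Definition lvp_output (V : veering) (r : lvp_run V) :
    gring 'rV[int]_(fp_rk (run_fp r)) :=
  \det (\matrix_(i, j) lvp_entry (run_fp r) (run_E r i) (run_T r j)).

(* Main.v *)
From HB Require Import structures.
Require Import Defs.
From Stdlib Require Import Relation_Operators.
From mathcomp Require Import all_boot all_fingroup all_algebra.
From mathcomp Require Import generic_quotient ring_quotient finmap.
From mathcomp Require Import boolp classical_sets.
From mathcomp Require Import monalg zify.

Set Implicit Arguments.
Unset Strict Implicit.
Unset Printing Implicit Defensive.

Import GRing.Theory.
Local Open Scope ring_scope.

(** Row e of the lower veering matrix records how the edge e sits in each of
    the tetrahedra around it, so the proof walks around e.

    Turning about e, the coorientation of the triangle just crossed reverses
    exactly at the tetrahedra having e as a diagonal. As the angles sum to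
    2 pi, e is the top diagonal of one tetrahedron and the bottom diagonal of
    one ([top_bot_count]); hence each side of e is a sequence of upward
    triangles from the former to the latter, and the loop around e is the
    right side minus the left side ([loop_sides]), a column of the branch
    equations.

    The cycles of the dual graph X are determined freely by their values off
    the spanning tree, so they have a basis g_i restricting to the columns of
    U^-1. In U B_Y V = S the nonzero rows make the first g_i torsion in M
    ([smith_torsion]), while the zero rows make the remaining coordinates
    vanish on all loops ([coord_torsion]). So the last r of the g_i give a
    basis of H, and for every cycle z the class of z is the combination of
    that basis with coefficients the sum of the exponents of the face
    Laurents over z ([basis_map_free_coord]).

    In the cover, going up from the bottom of e through the first n triangles
    of a side adds their classes; so e has in the tetrahedron reached the
    coefficient prescribed by the algorithm, up to the ratio of two units that
    depend on the chosen lifts of the top and bottom tetrahedra of this path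
    ([edge_coef_laurent]). This ratio conjugates the matrix by a diagonal
    matrix, which the determinant does not see; for the same reason the
    fundamental domain may be arbitrary.

    It remains to see which equatorial embeddings count. The colours of a
    triangle, read cyclically, are prescribed both by the tetrahedron below
    and by the one above it. Comparing the two, the top diagonal of the former
    and the bottom diagonal of the latter are distinct edges of the triangle
    with the same colour, and the third edge has the other colour
    ([face_colours]). So, of the equatorial tetrahedra on a side of e, only
    the lowest one fails to count ([weight_side]), which is where the sums in
    the algorithm start. *)

(** * Flags and turning about an edge *)

Lemma ord4_cases (i : 'I_4) : [\/ i = v0, i = v1, i = v2 | i = v3].
Proof.
by case: i => [[|[|[|[|]]]]] // h;
  [constructor 1 | constructor 2 | constructor 3 | constructor 4]; apply: val_inj.
Qed.

Lemma medge_inj (A B : medge) : val A = val B -> A = B.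
Proof. exact: val_inj. Qed.

Lemma tperm_values :
  ((tperm v0 v1 v0 = v1) * (tperm v0 v1 v1 = v0) *
   (tperm v0 v1 v2 = v2) * (tperm v0 v1 v3 = v3) *
   (tperm v2 v3 v0 = v0) * (tperm v2 v3 v1 = v1) *
   (tperm v2 v3 v2 = v3) * (tperm v2 v3 v3 = v2))%type.
Proof. by rewrite !tpermL !tpermR !tpermD. Qed.

Section FlagCombinatorics.
Variable M : triangulation.
Local Notation T := (tet M).
Local Notation turn := (turn M).
Local Notation cross := (cross M).
Implicit Types x y : flag T.

Definition unturn x : flag T := cross (swap v2 v3 x).
(** The same embedded edge from its other end and at its other face; the parity
    of the labelling is kept. *)
Definition reverse x : flag T := swap v0 v1 (swap v2 v3 x).
(** The embedding of an edge into a tetrahedron that a flag lies on. *)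
Definition emb x : T * medge := (x.1, fedge x).

Lemma swapK i j : involutive (@swap T i j).
Proof. by case=> t p; rewrite /swap /= mulgA tperm2 mul1g. Qed.

Lemma turnK : cancel turn unturn.
Proof. by move=> x; rewrite /unturn /Defs.turn swapK cross_involutive. Qed.

Lemma unturnK : cancel unturn turn.
Proof. by move=> x; rewrite /unturn /Defs.turn cross_involutive swapK. Qed.

Lemma cross_swap i j x :
  i != v3 -> j != v3 -> cross (swap i j x) = swap i j (cross x).
Proof.
by move=> hi hj; rewrite /Defs.cross /swap /= permM tpermD // mulgA.
Qed.

Lemma swap01_swap23 x : swap v0 v1 (swap v2 v3 x) = swap v2 v3 (swap v0 v1 x).
Proof.
rewrite /swap /=; congr pair; rewrite !mulgA; congr (_ * _)%g.
apply/permP => i; rewrite !permM.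
by case: (ord4_cases i) => ->; rewrite !tperm_values.
Qed.

Lemma swap23_turn x : swap v2 v3 (turn x) = cross x.
Proof. exact: swapK. Qed.

Lemma turn_swap23 x : turn (swap v2 v3 x) = swap v2 v3 (unturn x).
Proof. by []. Qed.

Lemma turn_swap01 x : turn (swap v0 v1 x) = swap v0 v1 (turn x).
Proof. by rewrite /Defs.turn cross_swap // swap01_swap23. Qed.

Lemma unturn_swap01 x : unturn (swap v0 v1 x) = swap v0 v1 (unturn x).
Proof. by rewrite /unturn -swap01_swap23 cross_swap. Qed.

Lemma unturn_reverse x : unturn (reverse x) = reverse (turn x).
Proof.
by rewrite /reverse unturn_swap01 /unturn swapK swap23_turn.
Qed.

Lemma iter_turn_swap01 n x :
  iter n turn (swap v0 v1 x) = swap v0 v1 (iter n turn x).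
Proof. by elim: n => //= n ->; rewrite turn_swap01. Qed.

Lemma iter_turn_swap23 n x :
  iter n turn (swap v2 v3 x) = swap v2 v3 (iter n unturn x).
Proof. by elim: n => //= n ->; rewrite turn_swap23. Qed.

Lemma iter_unturn n x : iter n unturn (iter n turn x) = x.
Proof. by elim: n x => //= n IH x; rewrite -iterS iterSr /= turnK IH. Qed.

Lemma odd_swap i j x : i != j -> odd_perm (swap i j x).2 = ~~ odd_perm x.2.
Proof. by move=> ij; rewrite /swap /= odd_permM odd_tperm ij addTb. Qed.

Lemma odd_cross x : odd_perm (cross x).2 = ~~ odd_perm x.2.
Proof. by rewrite /Defs.cross /= odd_permM tri_oriented addbT. Qed.

Lemma odd_turn x : odd_perm (turn x).2 = odd_perm x.2.
Proof. by rewrite /Defs.turn odd_swap // odd_cross negbK. Qed.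

Lemma odd_iter_turn n x : odd_perm (iter n turn x).2 = odd_perm x.2.
Proof. by elim: n => //= n IH; rewrite odd_turn. Qed.

Lemma fedge_swap01 x : fedge (swap v0 v1 x) = fedge x.
Proof. by apply: medge_inj; rewrite /= !permM tpermL tpermR finset.setUC. Qed.

Lemma fedge_swap23 x : fedge (swap v2 v3 x) = fedge x.
Proof. by apply: medge_inj; rewrite /= !permM !tpermD. Qed.

Lemma emb_swap01 x : emb (swap v0 v1 x) = emb x.
Proof. by rewrite /emb fedge_swap01. Qed.

Lemma emb_swap23 x : emb (swap v2 v3 x) = emb x.
Proof. by rewrite /emb fedge_swap23. Qed.

Lemma emb_cross x : emb (cross x) = edge_across M (x.2 v3) (emb x).
Proof.
congr pair; apply: medge_inj; rewrite /= !permM.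
by apply/setP => i; rewrite imsetU !imset_set1.
Qed.

Lemma emb_turn x : emb (turn x) = edge_across M (x.2 v3) (emb x).
Proof. by rewrite emb_swap23 emb_cross. Qed.

Lemma emb_unturn x : emb (unturn x) = edge_across M (x.2 v2) (emb x).
Proof. by rewrite emb_cross emb_swap23 /= permM tpermR. Qed.

Lemma notin_fedge x i : i \notin val (fedge x) -> i = x.2 v2 \/ i = x.2 v3.
Proof.
rewrite -[i](permKV x.2) /= !inE !(inj_eq perm_inj).
by case: (ord4_cases ((x.2)^-1%g i)) => ->; rewrite ?eqxx ?orbT //; [left|right].
Qed.

Lemma fedge_notin x : (x.2 v2 \notin val (fedge x)) && (x.2 v3 \notin val (fedge x)).
Proof. by rewrite /= !inE !(inj_eq perm_inj). Qed.

Lemma edge_stepP x z : edge_step (emb x) z -> z = emb (turn x) \/ z = emb (unturn x).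
Proof.
case/existsP => i /andP [/notin_fedge [->|->] /eqP ->]; [right|left].
  by rewrite emb_unturn.
by rewrite emb_turn.
Qed.

Lemma edge_step_turn x : edge_step (emb x) (emb (turn x)).
Proof.
apply/existsP; exists (x.2 v3); rewrite emb_turn eqxx andbT.
by case/andP: (fedge_notin x).
Qed.

Lemma mem_orbit_turn x y :
  (turn y \in fingraph.orbit turn x) = (y \in fingraph.orbit turn x).
Proof. by rewrite -!fconnect_orbit -(same_fconnect1_r (@turn_inj M)). Qed.

Lemma mem_orbit_unturn x y :
  (unturn y \in fingraph.orbit turn x) = (y \in fingraph.orbit turn x).
Proof. by rewrite -mem_orbit_turn unturnK. Qed.

(** The only triangles at an embedded edge are the two that turning passes
    through, forwards and backwards. *)
Lemma edge_class_emb x : edge_class (emb x) = [set emb y | y in fingraph.orbit turn x].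
Proof.
apply/setP => z; rewrite inE; apply/idP/imsetP.
  case/connectP => s; elim/last_ind: s z => [|s a IH] z /=.
    by move=> _ ->; exists x => //; rewrite -fconnect_orbit connect0.
  rewrite rcons_path last_rcons => /andP [/IH {}IH ha] ->.
  have [y hy e] := IH _ erefl; move: ha; rewrite e.
  case/edge_stepP => ->; first by exists (turn y); rewrite ?mem_orbit_turn.
  by exists (unturn y); rewrite ?mem_orbit_unturn.
case=> y; rewrite -fconnect_orbit => /connectP [s hs ->] ->{z y}.
elim: s x hs => [|a s IH] x /=; first by rewrite connect0.
case/andP => /eqP <- /IH; apply: connect_trans; apply: connect1.
exact: edge_step_turn.
Qed.

Lemma edge_of_eqP (z z' : T * medge) :
  reflect (edge_class z = edge_class z') (edge_of z == edge_of z').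
Proof. by apply: (iffP eqP) => [/(congr1 val) //|h]; apply: val_inj. Qed.

Lemma edge_of_turn x : edge_of (emb (turn x)) = edge_of (emb x).
Proof.
apply/eqP/edge_of_eqP; rewrite !edge_class_emb; apply/setP => z.
have h y : (y \in fingraph.orbit turn (turn x)) = (y \in fingraph.orbit turn x).
  by rewrite -!fconnect_orbit -(same_fconnect1 (@turn_inj M)).
by apply/imsetP/imsetP => -[y hy ->]; exists y; rewrite // ?h // -h.
Qed.

Lemma edge_of_iter n x : edge_of (emb (iter n turn x)) = edge_of (emb x).
Proof. by elim: n => //= n IH; rewrite edge_of_turn. Qed.

Lemma edge_of_orbit x z :
  (edge_of z == edge_of (emb x)) = (z \in edge_class (emb x)).
Proof.
apply/idP/idP => [/edge_of_eqP <-|]; first by rewrite inE connect0.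
rewrite edge_class_emb => /imsetP [y]; rewrite -fconnect_orbit => /iter_findex <- ->.
by rewrite edge_of_iter.
Qed.

Lemma perm_stab01 (s : {perm 'I_4}) : (s v0 \in [:: v0; v1]) -> (s v1 \in [:: v0; v1]) ->
  [\/ s = 1, s = tperm v0 v1, s = tperm v2 v3 | s = (tperm v2 v3 * tperm v0 v1)]%g.
Proof.
rewrite !inE => h0 h1.
have n01 : s v0 != s v1 by rewrite (inj_eq perm_inj).
have n02 : s v0 != s v2 by rewrite (inj_eq perm_inj).
have n12 : s v1 != s v2 by rewrite (inj_eq perm_inj).
have n03 : s v0 != s v3 by rewrite (inj_eq perm_inj).
have n13 : s v1 != s v3 by rewrite (inj_eq perm_inj).
have n23 : s v2 != s v3 by rewrite (inj_eq perm_inj).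
case/orP: h0 n01 n02 n12 n03 n13 n23 => /eqP e0; case/orP: h1 => /eqP e1;
  rewrite e0 e1 ?eqxx //; move=> _;
  case: (ord4_cases (s v2)) => e2; rewrite e2 ?eqxx //;
  case: (ord4_cases (s v3)) => e3; rewrite e3 ?eqxx // => _ _ _ _ _;
  [constructor 1|constructor 3|constructor 2|constructor 4];
  apply/permP => i; rewrite ?permM ?perm1; case: (ord4_cases i) => ->;
  by rewrite ?(e0, e1, e2, e3) ?tperm_values.
Qed.

Lemma emb_fiber x y : emb x = emb y ->
  [\/ x = y, x = swap v0 v1 y, x = swap v2 v3 y | x = reverse y].
Proof.
case: x y => [t p] [u q] [<-{u}] /setP h.
have hs i : i \in [:: v0; v1] -> (p * q^-1)%g i \in [:: v0; v1].
  rewrite !inE permM => hi; have := h (p i); rewrite !inE !(inj_eq perm_inj) hi.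
  by move/esym; rewrite -{1 2}(permKV q (p i)) !(inj_eq perm_inj).
have -> : p = ((p * q^-1) * q)%g by rewrite mulgKV.
have [||->|->|->|->] := @perm_stab01 (p * q^-1)%g; rewrite ?hs ?inE ?eqxx ?orbT //.
- by rewrite mul1g; constructor.
- by constructor 2.
- by constructor 3.
by constructor 4; rewrite /reverse swap01_swap23 /swap /= mulgA.
Qed.

(** No edge is glued to itself with its ends exchanged: reversal conjugates
    turning to its inverse, so such an identification could be halved until it
    fixes a flag or folds a triangle onto itself. *)
Lemma iter_turn_neq_reverse n x : iter n turn x <> reverse x.
Proof.
elim/ltn_ind: n x => -[|[|n]] IH x /=.
- case: x => t p [] /permP /(_ v0).
  by rewrite !permM tpermL (tpermD (x := v2)) // => /perm_inj.
- move=> /(congr1 (swap v2 v3)); rewrite swap23_turn /reverse swap01_swap23 swapK.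
  case: x => t p; rewrite /Defs.cross /swap /= => -[e1 /permP /(_ v3)].
  rewrite !permM tpermD // => e2.
  by have := tri_unfolded t (p v3); rewrite e1 e2 eqxx.
move=> /(congr1 unturn); rewrite turnK unturn_reverse -iterS iterSr.
exact: (IH n).
Qed.

(** A flag in the fibre of an embedded edge is determined by its parity, which
    turning preserves, up to reversal, which turning cannot achieve. *)
Lemma emb_orbit_inj x : {in fingraph.orbit turn x &, injective emb}.
Proof.
move=> y z; rewrite -!fconnect_orbit => hy hz /emb_fiber.
have hzy : fconnect turn z y.
  by apply: connect_trans hy; rewrite (fconnect_sym (@turn_inj M)).
have ho : odd_perm y.2 = odd_perm z.2.
  by rewrite -(iter_findex hzy) odd_iter_turn.
case=> // e; move: ho; rewrite e ?odd_swap //.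
- by case: odd_perm.
- by case: odd_perm.
by move=> _; case: (@iter_turn_neq_reverse (findex turn z y) z); rewrite iter_findex.
Qed.

(** This is how sums over all embeddings of an edge, such as the sum of its
    angles, become sums along one turn around it. *)
Lemma big_edge (R : Type) (idx : R) (op : Monoid.com_law idx) (F : T * medge -> R) x :
  \big[op/idx]_(z | edge_of z == edge_of (emb x)) F z =
  \big[op/idx]_(y <- fingraph.orbit turn x) F (emb y).
Proof.
rewrite (eq_bigl (mem (edge_class (emb x)))); last by move=> z; exact: edge_of_orbit.
rewrite edge_class_emb big_imset /=; last exact: emb_orbit_inj.
by rewrite big_uniq ?orbit_uniq //.
Qed.

End FlagCombinatorics.

(** * The two sides of an edge *)

Section TautEdges.
Variables (M : triangulation) (al : coorientation M).
Local Notation T := (tet M).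
Local Notation turn := (turn M).
Local Notation unturn := (@unturn M).
Local Notation cross := (cross M).
Local Notation order := (fingraph.order turn).
Local Notation orbit := (fingraph.orbit turn).
Implicit Types x y : flag T.

Definition out x (i : 'I_4) := outward al x.1 (x.2 i).
Definition at_top x := fedge x == top_diag al x.1.
Definition at_bot x := fedge x == bot_diag al x.1.

Lemma outward_sum x : (out x v0 + out x v1 + out x v2 + out x v3 = 2)%N.
Proof.
have h : #|[set i | outward al x.1 i]| = 2%N by exact: eqP (outward_two al x.1).
rewrite -h -sum1dep_card big_mkcond /=.
rewrite (reindex_inj (@perm_inj _ x.2)) /= !big_ord_recl big_ord0 /= /out.
have e i j : val i = val j ->
    (outward al x.1 (x.2 i) : nat) = (if outward al x.1 (x.2 j) then 1 else 0)%N.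
  by move=> /val_inj ->; case: outward.
by rewrite addn0 !addnA; do !congr addn; apply: e.
Qed.

(** The faces of a flag's tetrahedron that contain its edge are those opposite
    to the vertices 2 and 3. *)
Lemma at_topP x : at_top x = out x v2 && out x v3.
Proof.
apply/eqP/andP => [/(congr1 val) /= /setP h|[h2 h3]].
  have := h (x.2 v2); have := h (x.2 v3); rewrite !inE !(inj_eq perm_inj) /=.
  by rewrite /out => /esym /negbFE -> /esym /negbFE ->.
have := outward_sum x; rewrite h2 h3.
case h0 : (out x v0); case h1 : (out x v1) => // _.
apply: medge_inj; apply/setP => i; rewrite /= !inE -[i](permKV x.2).
move: h0 h1 h2 h3; rewrite /out !(inj_eq perm_inj).
by case: (ord4_cases ((x.2)^-1%g i)) => -> h0 h1 h2 h3; rewrite ?(h0, h1, h2, h3).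
Qed.

Lemma at_botP x : at_bot x = ~~ out x v2 && ~~ out x v3.
Proof.
apply/eqP/andP => [/(congr1 val) /= /setP h|[h2 h3]].
  have := h (x.2 v2); have := h (x.2 v3); rewrite !inE !(inj_eq perm_inj) /=.
  by rewrite /out => <- <-.
have := outward_sum x; rewrite (negPf h2) (negPf h3).
case h0 : (out x v0); case h1 : (out x v1) => // _.
apply: medge_inj; apply/setP => i; rewrite /= !inE -[i](permKV x.2).
move: h0 h1 h2 h3; rewrite /out !(inj_eq perm_inj).
by case: (ord4_cases ((x.2)^-1%g i)) => -> h0 h1 /negPf h2 /negPf h3;
  rewrite ?(h0, h1, h2, h3).
Qed.

Lemma out_turn x : out (turn x) v2 = ~~ out x v3.
Proof. by rewrite /out /= !permM tpermL outward_glue. Qed.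

Lemma at_top_swap23 x : at_top (swap v2 v3 x) = at_top x.
Proof. by rewrite /at_top fedge_swap23. Qed.

Lemma at_bot_swap23 x : at_bot (swap v2 v3 x) = at_bot x.
Proof. by rewrite /at_bot fedge_swap23. Qed.

Lemma angle_emb x : angle al (emb x) = (at_top x + at_bot x)%N.
Proof.
rewrite /angle /= -/(at_top x) -/(at_bot x) at_topP at_botP.
by case: (out x v2); case: (out x v3).
Qed.

Hypothesis tautM : taut al.

Lemma orbit_angle x : (\sum_(y <- orbit x) (at_top y + at_bot y) = 2)%N.
Proof.
apply: etrans (tautM (edge_of (emb x))).
by rewrite big_edge; apply: eq_bigr => y _; rewrite angle_emb.
Qed.

(** The number of triangles met before the tetrahedron above the edge is
    reached. *)
Definition height x := find at_bot (orbit x).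

Lemma nth_orbit x i : (i < order x)%N -> nth x (orbit x) i = iter i turn x.
Proof. by move=> h; rewrite /orbit nth_traject. Qed.

Lemma iter_turn_order x : iter (order x) turn x = x.
Proof. exact: (iter_order (@turn_inj M)). Qed.

(** Without a bottom diagonal the triangles crossed after x would all be
    cooriented forwards, and coming back to x one would enter its tetrahedron
    through a bottom face; but the faces at its top diagonal are top faces. *)
Lemma has_bot x : at_top x -> has at_bot (orbit x).
Proof.
move=> tx; apply/negPn/negP => hb.
have nb i : (i < order x)%N -> ~~ at_bot (iter i turn x).
  move=> hi; apply: contra hb => h; apply/hasP; exists (iter i turn x) => //.
  by rewrite -fconnect_orbit fconnect_iter.
have o3 i : (i < order x)%N -> out (iter i turn x) v3.
  elim: i => [|i IH] hi; first by move: tx; rewrite at_topP => /andP [].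
  have := nb _ hi; rewrite at_botP /= out_turn (IH (ltnW hi)) /=.
  by rewrite negbK.
have d0 : (0 < order x)%N by exact: fingraph.order_gt0.
have := tx; rewrite -{1}(iter_turn_order x) -(prednK d0) at_topP /= out_turn o3 //.
by rewrite (prednK d0).
Qed.

Lemma height_lt x : at_top x -> (height x < order x)%N.
Proof. by move=> /has_bot; rewrite has_find size_orbit. Qed.

Lemma at_bot_height x : at_top x -> at_bot (iter (height x) turn x).
Proof.
by move=> tx; rewrite -nth_orbit ?height_lt // nth_find // has_bot.
Qed.

Lemma height_gt0 x : at_top x -> (0 < height x)%N.
Proof.
move=> tx; rewrite lt0n; apply/negP => /eqP h; have := at_bot_height tx.
by rewrite h /= at_botP; move: tx; rewrite at_topP => /andP [-> ->].
Qed.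

(** The positions 0 and height x already use up the total angle 2. *)
Lemma top_bot_count x i : at_top x -> (i < order x)%N ->
  (at_top (iter i turn x) = (i == 0%N)) * (at_bot (iter i turn x) = (i == height x)).
Proof.
move=> tx hi; have := orbit_angle x.
have hk := height_lt tx; have k0 := height_gt0 tx; have bk := at_bot_height tx.
have nt : at_bot x = false by move: tx; rewrite at_topP at_botP => /andP [-> ->].
have nb : at_top (iter (height x) turn x) = false.
  by move: bk; rewrite at_topP at_botP => /andP [/negPf -> /negPf ->].
have d0 : (0 < order x)%N by exact: fingraph.order_gt0.
rewrite (big_nth x) size_orbit big_mkord (bigD1 (Ordinal d0)) //=.
rewrite (bigD1 (Ordinal hk)) /=; last by rewrite -val_eqE /= -lt0n.
rewrite !nth_orbit // bk nb /= tx nt addnA => /eqP; rewrite -[X in _ == X]addn0 eqn_add2l.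
rewrite sum_nat_eq0 => /forallP /(_ (Ordinal hi)) /implyP.
rewrite -!val_eqE /= nth_orbit // addn_eq0 !eqb0.
case: eqVneq => [->|i0]; first by rewrite tx nt eq_sym (gtn_eqF k0).
case: eqVneq => [->|ik]; first by rewrite bk nb.
by move=> /(_ isT) /andP [/negPf -> /negPf ->].
Qed.

Lemma out_iter x i : at_top x -> (i < order x)%N ->
  out (iter i turn x) v3 = (i < height x)%N.
Proof.
move=> tx; elim: i => [|i IH] hi.
  by move: (tx); rewrite at_topP height_gt0 // => /andP [].
have [] := top_bot_count tx hi; rewrite at_topP at_botP /= out_turn (IH (ltnW hi)).
by rewrite negbK; case: (ltngtP i.+1 (height x)) => h /=; case: out.
Qed.

Lemma top_unique x y : at_top x -> at_top y -> y \in orbit x -> y = x.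
Proof.
move=> tx ty; rewrite -fconnect_orbit => hy.
move: ty; rewrite -(iter_findex hy) (top_bot_count tx (findex_max hy)).1.
by move=> /eqP ->.
Qed.

End TautEdges.

(** * The loop around an edge *)

Section EdgeLoops.
Variables (M : triangulation) (al : coorientation M).
Local Notation T := (tet M).
Local Notation turn := (turn M).
Local Notation unturn := (@unturn M).
Local Notation cross := (cross M).
Local Notation order := (fingraph.order turn).
Local Notation orbit := (fingraph.orbit turn).
Implicit Types x y : flag T.

Lemma mem_orbit_iter_unturn n x y :
  (iter n unturn y \in orbit x) = (y \in orbit x).
Proof. by elim: n => //= n IH; rewrite mem_orbit_unturn. Qed.

Lemma mem_orbit_self x : x \in orbit x.
Proof. by rewrite -fconnect_orbit connect0. Qed.

Lemma mem_orbit_swap23 x y : (y \in orbit (swap v2 v3 x)) = (swap v2 v3 y \in orbit x).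
Proof.
have h z u : u \in orbit (swap v2 v3 z) -> swap v2 v3 u \in orbit z.
  rewrite -fconnect_orbit => /iter_findex <-.
  by rewrite iter_turn_swap23 swapK mem_orbit_iter_unturn mem_orbit_self.
apply/idP/idP => [/h //|hy].
by rewrite -[y](swapK v2 v3); apply: h; rewrite swapK.
Qed.

Lemma mem_orbit_swap01 x y : (y \in orbit (swap v0 v1 x)) = (swap v0 v1 y \in orbit x).
Proof.
have h z u : u \in orbit (swap v0 v1 z) -> swap v0 v1 u \in orbit z.
  rewrite -!fconnect_orbit => /iter_findex <-.
  by rewrite iter_turn_swap01 swapK fconnect_iter.
apply/idP/idP => [/h //|hy].
by rewrite -[y](swapK v0 v1); apply: h; rewrite swapK.
Qed.

Lemma mem_orbit_iter n x y : (y \in orbit (iter n turn x)) = (y \in orbit x).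
Proof.
rewrite -!fconnect_orbit; elim: n => //= n <-.
by rewrite -(same_fconnect1 (@turn_inj M)).
Qed.

Lemma order_swap23 x : order (swap v2 v3 x) = order x.
Proof.
rewrite /order -!sum1_card (reindex_inj (can_inj (@swapK M v2 v3))) /=.
apply: eq_bigl => y; rewrite -![_ \in fconnect _ _]topredE /= !fconnect_orbit.
by rewrite mem_orbit_swap23 swapK.
Qed.

(** Exchanging the vertices 2 and 3 reverses the direction of turning, so the
    left side of an edge is the right side of the exchanged flag. *)
Lemma iter_turn_swap23_sub i x : (i <= order x)%N ->
  iter i turn (swap v2 v3 x) = swap v2 v3 (iter (order x - i) turn x).
Proof.
move=> hi; rewrite iter_turn_swap23 -{1}(iter_turn_order x) -{1}(subnKC hi).
by rewrite iterD iter_unturn.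
Qed.

Definition flag_face x : face al := face_of al (x.1, x.2 v3).
Definition flag_step x : chain1 al := step al x.1 (x.2 v3).

Lemma flag_stepE x :
  flag_step x = if out al x v3 then dual_edge (flag_face x) else - dual_edge (flag_face x).
Proof. by []. Qed.

Lemma flag_face_cross x : flag_face (cross x) = flag_face x.
Proof.
apply: val_inj; rewrite /= /side_below /= permM outward_glue.
have [-> ->] := tri_glueK x.1 (x.2 v3); rewrite permK.
by case: (outward al x.1 (x.2 v3)).
Qed.

Lemma flag_step_cross x : flag_step (cross x) = - flag_step x.
Proof.
rewrite !flag_stepE flag_face_cross /out /= permM outward_glue.
by case: outward; rewrite //= opprK.
Qed.

Lemma loop_sum x : loop al x = \sum_(y | y \in orbit x) flag_step y.
Proof. by rewrite /loop big_uniq // orbit_uniq. Qed.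

Lemma loop_iter n x : loop al (iter n turn x) = loop al x.
Proof. by rewrite !loop_sum; apply: eq_bigl => y; rewrite mem_orbit_iter. Qed.

Lemma loop_swap01 x : loop al (swap v0 v1 x) = loop al x.
Proof.
rewrite !loop_sum (reindex_inj (can_inj (@swapK M v0 v1))) /=.
apply: eq_big => y; first by rewrite mem_orbit_swap01 swapK.
by move=> _; rewrite /flag_step /= permM tpermD.
Qed.

Lemma loop_swap23 x : loop al (swap v2 v3 x) = - loop al x.
Proof.
rewrite !loop_sum (reindex_inj (can_inj (@cross_involutive M))) /= -sumrN.
apply: eq_big => y; last by move=> _; rewrite flag_step_cross.
by rewrite mem_orbit_swap23 -/(turn y) mem_orbit_turn.
Qed.

Lemma loop_orbit x : loop al x = \sum_(j < order x) flag_step (iter j turn x).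
Proof.
rewrite /loop (big_nth x) size_orbit big_mkord; apply: eq_bigr => j _.
by rewrite nth_orbit.
Qed.

Lemma loop_same_edge x y : edge_of (emb x) = edge_of (emb y) ->
  loop al x = loop al y \/ loop al x = - loop al y.
Proof.
move/eqP; rewrite edge_of_orbit edge_class_emb => /imsetP [z].
rewrite -fconnect_orbit => /iter_findex <-; set n := findex _ _ _ => /emb_fiber.
by case=> ->; rewrite ?loop_swap01 ?loop_swap23 ?loop_iter; [left|left|right|right].
Qed.

Hypothesis tautM : taut al.

Lemma height_swap23 x : at_top al x ->
  height al (swap v2 v3 x) = (order x - height al x)%N.
Proof.
move=> tx; have tx' : at_top al (swap v2 v3 x) by rewrite at_top_swap23.
have hk := height_lt tx; have k0 := height_gt0 tx.
have hi : (order x - height al x < order (swap v2 v3 x))%N.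
  by rewrite order_swap23 ltn_subrL k0 (leq_ltn_trans _ hk).
have [_] := top_bot_count tautM tx' hi.
rewrite iter_turn_swap23_sub ?leq_subr // subKn ?(ltnW hk) // at_bot_swap23.
by rewrite (at_bot_height tx) => /esym /eqP.
Qed.

Definition side_faces x : seq (face al) :=
  [seq flag_face y | y <- take (height al x) (orbit x)].

Lemma size_side_faces x : at_top al x -> size (side_faces x) = height al x.
Proof. by move=> tx; rewrite size_map size_takel // size_orbit ltnW // height_lt. Qed.

Lemma nth_side_faces f0 x i : at_top al x -> (i < height al x)%N ->
  nth f0 (side_faces x) i = flag_face (iter i turn x).
Proof.
move=> tx hi; have hd := ltn_trans hi (height_lt tx).
rewrite (nth_map x) ?size_takel ?size_orbit ?(ltnW (height_lt tx)) //.
by rewrite nth_take // nth_orbit.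
Qed.

Lemma sum_take_side x i : at_top al x -> (i <= height al x)%N ->
  \sum_(f <- take i (side_faces x)) dual_edge f = \sum_(j < i) flag_step (iter j turn x).
Proof.
move=> tx hi.
have f0 := flag_face x.
rewrite (big_nth f0) size_takel ?size_side_faces // big_mkord.
apply: eq_bigr => j _; have hj := leq_trans (ltn_ord j) hi.
rewrite nth_take // nth_side_faces // flag_stepE out_iter //.
  by rewrite hj.
exact: ltn_trans hj (height_lt tx).
Qed.

(** The triangles after position height x are those of the other side, in
    reverse order and crossed downwards. *)
Lemma loop_sides x : at_top al x ->
  loop al x = \sum_(f <- side_faces x) dual_edge f
            - \sum_(f <- side_faces (swap v2 v3 x)) dual_edge f.
Proof.
move=> tx; have tx' : at_top al (swap v2 v3 x) by rewrite at_top_swap23.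
have hk := height_lt tx.
rewrite loop_orbit -(big_mkord xpredT (fun j => flag_step (iter j turn x))).
rewrite (big_cat_nat _ (ltnW hk)) //= big_mkord -sum_take_side //.
rewrite -{1}size_side_faces // take_size; congr (_ + _).
have f0 := flag_face x.
rewrite (big_nth f0) size_side_faces // height_swap23 // -sumrN.
rewrite -{1}[height al x]add0n big_addn.
rewrite big_nat_rev /= big_nat [RHS]big_nat; apply: eq_bigr => j /andP [_ hj].
rewrite nth_side_faces // ?height_swap23 //.
rewrite add0n iter_turn_swap23_sub; last by lia.
have -> : (order x - height al x - j.+1 + height al x = (order x - j).-1)%N by lia.
have -> : (order x - j = (order x - j).-1.+1)%N by lia.
rewrite flag_stepE out_iter //; last by lia.
rewrite /= -/(turn _) swap23_turn flag_face_cross.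
by case: ltnP => // h; exfalso; lia.
Qed.

End EdgeLoops.

(** * Cycles and spanning trees *)

Lemma telescope_sub (Z : zmodType) (a b c : Z) : a - b + (b - c) = a - c.
Proof. by rewrite addrA subrK. Qed.

Section Cycles.
Variables (M : triangulation) (al : coorientation M).
Implicit Types z : chain1 al.

Lemma bd_sub0 y z : bd y = 0 -> bd z = 0 -> bd (y - z) = 0.
Proof. by move=> hy hz; rewrite raddfB /= hy hz subrr. Qed.

Lemma bd_mulz0 z m : bd z = 0 -> bd (z *~ m) = 0.
Proof. by move=> hz; rewrite raddfMz /= hz mul0rz. Qed.

Lemma bd_sum0 (I : finType) (F : I -> chain1 al) :
  (forall i, bd (F i) = 0) -> bd (\sum_i F i) = 0.
Proof. by move=> h; rewrite (raddf_sum (@bd _ al)) big1 // => i _; exact: h. Qed.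

End Cycles.

Section Trees.
Variable V : veering.
Local Notation T := (tet V).
Local Notation al := (vcoor V).
Variable Y : {set face al}.
Hypothesis Ytree : spanning_tree Y.

Definition tree_supported (c : chain1 al) := forall f, f \notin Y -> c f = 0.

Lemma tree_chain t t' : exists2 c, tree_supported c & bd c = pt t' - pt t.
Proof.
case: Ytree => _ /(_ t t') /connectP [s hs ->] {t'}.
elim: s t hs => [|u s IH] t /=.
  by move=> _; exists 0 => [f _|]; rewrite ?ffunE // raddf0 subrr.
case/andP => /exists_inP [f fY hf] /IH [c cY hc].
have supp m : tree_supported (c + dual_edge f *~ m).
  move=> g gY; rewrite !ffunE ffunMzE ffunE cY //.
  by case: eqP gY => [->|]; rewrite ?fY // mul0rz addr0.
case/orP: hf => /andP [/eqP eb /eqP ea].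
  exists (c + dual_edge f *~ 1); first exact: supp.
  rewrite raddfD raddfMz /= hc bd_dual mulr1z eb ea; exact: telescope_sub.
exists (c + dual_edge f *~ (-1)); first exact: supp.
rewrite raddfD raddfMz /= hc bd_dual mulrN1z opprB eb ea; exact: telescope_sub.
Qed.

Lemma bd_tree_supported c : tree_supported c ->
  bd c = \sum_(i < #|Y|) bd (dual_edge (enum_val i)) *~ c (enum_val i).
Proof.
move=> cY; rewrite {1}/bd (bigID (mem Y)) /= [X in _ + X]big1 ?addr0; last first.
  by move=> f /cY ->; rewrite mulr0z.
by rewrite big_enum_val /=; apply: eq_bigr => i _; rewrite bd_dual.
Qed.

Lemma mulmx1C_eq (R : comNzRingType) m n (A : 'M[R]_(m, n)) (B : 'M[R]_(n, m)) :
  m = n -> A *m B = 1%:M -> B *m A = 1%:M.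
Proof. by move=> e; case: n / e A B => A B; exact: mulmx1C. Qed.

(** A counting argument instead of leaf removal: the boundaries of the tree
    edges and one base point form a square matrix, as the tree has one edge
    less than it has vertices; connectedness provides a left inverse, which is
    then also a right inverse. *)
Lemma tree_acyclic c : tree_supported c -> bd c = 0 -> c = 0.
Proof.
move=> cY bdc.
have /card_gt0P [t0 _] := tri_nonempty V.
have [p hp] := choice (fun t => let: ex_intro2 c h1 h2 := tree_chain t0 t in
  ex_intro (fun c => tree_supported c /\ bd c = pt t - pt t0) c (conj h1 h2)).
pose D : 'M[int]_(#|Y|, #|T|) := \matrix_(i, j) bd (dual_edge (enum_val i)) (enum_val j).
pose r : 'rV[int]_(#|T|) := \row_j pt t0 (enum_val j).
pose C : 'M[int]_(#|T|, #|Y|) := \matrix_(j, i) p (enum_val j) (enum_val i).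
have bdE (z : chain1 al) j : tree_supported z ->
    bd z (enum_val j) = \sum_i z (enum_val i) * D i j.
  move=> zY; rewrite bd_tree_supported // sum_ffunE; apply: eq_bigr => i _.
  by rewrite ffunMzE mxE mulrzz mulrC.
have e : row_mx (const_mx 1 : 'cV_#|T|) C *m col_mx r D = 1%:M.
  apply/matrixP => j l; rewrite mul_row_col !mxE big_ord1 !mxE mul1r.
  under eq_bigr => i _ do rewrite [C _ _]mxE.
  have [h1 h2] := hp (enum_val j).
  rewrite -bdE // h2 !ffunE addrC subrK -(inj_eq enum_val_inj).
  by rewrite eq_sym; case: eqVneq.
have {}e := mulmx1C_eq (esym Ytree.1) e.
pose v : 'rV[int]_(1 + #|Y|) := row_mx 0 (\row_i c (enum_val i)).
have hv : v *m col_mx r D = 0.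
  apply/matrixP => i j; rewrite mul_row_col mul0mx add0r !mxE.
  under eq_bigr => l _ do rewrite [(\row_i _) _ _]mxE.
  by rewrite -bdE // bdc ffunE.
have : v = 0 by rewrite -[v]mulmx1 -e mulmxA hv mul0mx.
rewrite -row_mx0 => /eq_row_mx [_ hc].
apply/ffunP => f; rewrite [RHS]ffunE; have [fY|/cY //] := boolP (f \in Y).
by have /rowP /(_ (enum_rank_in fY f)) := hc; rewrite !mxE enum_rankK_in.
Qed.

End Trees.

(** * The basis of H given by the Smith normal form *)

Section Homology.
Variables (V : veering) (w : edge_view V) (P : face_pairings w).
Local Notation T := (tet V).
Local Notation al := (vcoor V).
Local Notation nz := (fp_nz P).
Local Notation rk := (fp_rk P).
Local Notation tri_row := (@fp_row V w P).
Local Notation U := (fp_U P).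
Local Notation VV := (fp_V P).

Lemma at_top_view e : at_top al (w e).
Proof. by apply/eqP; exact: view_top. Qed.

Lemma count_chain (s : seq (face al)) f :
  (\sum_(g <- s) dual_edge g) f = (count_mem f s)%:Z.
Proof.
elim: s => [|g s IH]; first by rewrite big_nil ffunE.
by rewrite big_cons ffunE IH ffunE /= PoszD eq_sym; case: eqP.
Qed.

Lemma branch_loop e f : branch w f e = loop al (w e) f.
Proof. by rewrite (loop_sides (@vtaut V) (at_top_view e)) !ffunE !count_chain. Qed.

Lemma loop_torsion x : loop al x \in @torsion _ al.
Proof.
apply/asboolP; exists 1 => //; exists [ffun y => (y == x)%:Z].
rewrite mulr1z (bigD1 x) //= ffunE eqxx mulr1z big1 ?addr0 // => y /negPf.
by rewrite ffunE => ->; rewrite mulr0z.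
Qed.

Lemma torsion_sat z m : m != 0 -> z *~ m \in @torsion _ al -> z \in @torsion _ al.
Proof.
move=> m0 /asboolP [k k0 [c hc]]; apply/asboolP; exists (m * k).
  by rewrite mulf_neq0.
by exists c; rewrite mulrzA.
Qed.

Lemma cls_eq0 z : (cls z == 0) = (z \in @torsion _ al).
Proof. by rewrite -(raddf0 (@cls _ al)) -[z in RHS]subr0 Quotient.idealrBE. Qed.

Lemma cycle_with_values w0 : exists z, bd z = 0 /\ forall k, z (tri_row k) = w0 k.
Proof.
have [c hc] := choice (fun k =>
  let: ex_intro2 c h1 h2 := tree_chain (fp_treeP P) (above (tri_row k)) (below (tri_row k)) in
  ex_intro (fun c => tree_supported (fp_tree P) c /\
     bd c = pt (below (tri_row k)) - pt (above (tri_row k))) c (conj h1 h2)).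
exists (\sum_k (dual_edge (tri_row k) + c k) *~ w0 k); split=> [|k].
  rewrite raddf_sum big1 // => k _; rewrite raddfMz raddfD /= bd_dual (hc k).2.
  by rewrite telescope_sub subrr mul0rz.
have offY l : tri_row l \notin fp_tree P by rewrite -fp_rowP codom_f.
rewrite sum_ffunE (bigD1 k) //= big1 ?addr0 => [|l lk];
  rewrite ffunMzE !ffunE (hc _).1 // addr0.
  by rewrite eqxx mulrzz mul1r.
by rewrite (inj_eq (@fp_row_inj _ _ P)) eq_sym (negPf lk) mul0rz.
Qed.

(** For a cycle z, its coordinates in the basis of cycles that restricts off the
    tree to the columns of the inverse of U. *)
Definition coord i (z : chain1 al) : int := \sum_k U i k * z (tri_row k).

Lemma coord_is_zmod_morphism i : zmod_morphism (coord i).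
Proof.
move=> y z; rewrite /coord -sumrB; apply: eq_bigr => k _.
by rewrite !ffunE mulrBr.
Qed.
HB.instance Definition _ i :=
  GRing.isZmodMorphism.Build (chain1 al) int (coord i) (coord_is_zmod_morphism i).

Lemma coord_dual f (j : 'I_rk) : coord (rshift nz j) (dual_edge f) = laurent P f 0 j.
Proof.
rewrite /coord /laurent; case: pickP => [k /eqP <-|h].
  rewrite mxE (bigD1 k) //= ffunE eqxx mulr1 big1 ?addr0 // => l lk.
  by rewrite ffunE (inj_eq (@fp_row_inj _ _ P)) (negPf lk) mulr0.
by rewrite mxE big1 // => k _; rewrite ffunE h mulr0.
Qed.

Lemma cycle_eq0 z : bd z = 0 -> (forall k, z (tri_row k) = 0) -> z = 0.
Proof.
move=> bz hz; apply: (tree_acyclic (fp_treeP P)) bz => f.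
by rewrite -fp_rowP => /codomP [k ->].
Qed.

Lemma cycle_expansion (g : 'I_(nz + rk) -> chain1 al) z :
  (forall i, bd (g i) = 0) -> (forall i k, g i (tri_row k) = invmx U k i) ->
  bd z = 0 -> z = \sum_i g i *~ coord i z.
Proof.
move=> bg hg bz; apply/eqP; rewrite -subr_eq0; apply/eqP; apply: cycle_eq0.
  by apply: bd_sub0 => //; apply: bd_sum0 => i; apply: bd_mulz0.
move=> k; rewrite !ffunE sum_ffunE.
pose v := \col_l z (tri_row l).
have -> : z (tri_row k) = (invmx U *m (U *m v)) k 0.
  by rewrite mulKmx ?fp_U_unit // mxE.
rewrite mxE; apply/eqP; rewrite subr_eq0; apply/eqP; apply: eq_bigr => i _.
rewrite ffunMzE hg mulrzz mxE /coord; congr (_ * _).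
by apply: eq_bigr => l _; rewrite mxE.
Qed.

Local Notation branch_mx := (\matrix_(k, j) branch w (tri_row k) (fp_col P j)).

(** Row i of S = U B V has a single nonzero entry d, in some column j. Column j
    of B V = U^-1 S is then d times column i of U^-1; so d z and a combination
    of loops agree off the tree, hence everywhere. *)
Lemma smith_torsion (i : 'I_nz) z : bd z = 0 ->
  (forall k, z (tri_row k) = invmx U k (lshift rk i)) -> z \in @torsion _ al.
Proof.
move=> bz hz; have /= [[d _ hS] hrow] := fp_smith P.
have := hrow (lshift rk i); rewrite leqNgt /= ltn_ord /= => /negbT.
set S := U *m _ *m _ in hS hrow *.
case/rV0Pn => j; rewrite mxE => Sij.
apply: (torsion_sat Sij).
suff -> : z *~ S (lshift rk i) j = \sum_e loop al (w (fp_col P e)) *~ VV e j.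
  by apply: rpred_sum => e _; rewrite rpredMz // loop_torsion.
apply/eqP; rewrite -subr_eq0; apply/eqP; apply: cycle_eq0.
  apply: bd_sub0; first exact: bd_mulz0.
  by apply: bd_sum0 => e; apply: bd_mulz0; exact: bd_loop.
move=> k; rewrite !ffunE ffunMzE sum_ffunE hz.
have -> : \sum_e (loop al (w (fp_col P e)) *~ VV e j) (tri_row k) = (branch_mx *m VV) k j.
  rewrite mxE; apply: eq_bigr => e _.
  by rewrite ffunMzE mxE branch_loop mulrzz.
have -> : branch_mx *m VV = invmx U *m S by rewrite /S -mulmxA mulKmx ?fp_U_unit.
rewrite [in X in _ - X]mxE (bigD1 (lshift rk i)) //= big1 ?addr0 ?mulrzz ?subrr // => l li.
move: Sij; rewrite hS !mxE; have [e|_] := eqVneq (lshift rk i : nat) (j : nat).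
  move=> _; have [e'|_] := eqVneq (l : nat) (j : nat).
    by case/eqP: li; apply: val_inj; rewrite /= e' -e.
  by rewrite mulr0n mulr0.
by rewrite mulr0n eqxx.
Qed.

(** Row nz + j of U B V vanishes and V is invertible, so these rows of U kill
    the columns of B, which are the loops around the edges. *)
Lemma coord_torsion (j : 'I_rk) z : z \in @torsion _ al -> coord (rshift nz j) z = 0.
Proof.
have /= [_ hrow] := fp_smith P.
have := hrow (rshift nz j); rewrite /= leq_addr => /eqP hr.
have hU : row (rshift nz j) (U *m branch_mx) = 0.
  by rewrite -[LHS](mulmxK (fp_V_unit P)) -row_mul hr mul0mx.
have hw e : coord (rshift nz j) (loop al (w e)) = 0.
  have [col' _ colK] := fp_col_bij P.
  have /rowP /(_ (col' e)) := hU; rewrite !mxE => <-.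
  by apply: eq_bigr => k _; rewrite mxE colK branch_loop.
have hl x : coord (rshift nz j) (loop al x) = 0.
  have [|->|->] := @loop_same_edge _ al x (w (edge_of (emb x))).
  - by rewrite -[LHS](view_edge w).
  - exact: hw.
  by rewrite raddfN /= hw oppr0.
case/asboolP => m m0 [c /(congr1 (coord (rshift nz j)))].
rewrite raddfMz raddf_sum /= big1 => [|x _]; last by rewrite raddfMz /= hl mul0rz.
by move/eqP; rewrite mulrzz mulf_eq0 (negPf m0) orbF => /eqP.
Qed.

Lemma basis_exists (j : 'I_rk) : exists h : homology al, is_basis_class j h.
Proof.
have [z [bz hz]] := cycle_with_values (fun k => invmx U k (rshift nz j)).
have hc : cls z \in @cycles _ al by rewrite unfold_in qbd_cls bz.
by exists (Homology hc); exists z.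
Qed.

Definition basis_class (j : 'I_rk) : homology al := sval (cid (basis_exists j)).

Lemma basis_classP j : is_basis_class j (basis_class j).
Proof. exact: svalP. Qed.

Definition basis_map (v : 'rV[int]_rk) : homology al := \sum_j basis_class j *~ v 0 j.

Lemma basis_map_is_zmod_morphism : zmod_morphism basis_map.
Proof.
by move=> u v; rewrite /basis_map -sumrB; apply: eq_bigr => j _; rewrite !mxE mulrzBr.
Qed.
HB.instance Definition _ :=
  GRing.isZmodMorphism.Build 'rV[int]_rk (homology al) basis_map basis_map_is_zmod_morphism.

Lemma hval_basis_map v : hval (basis_map v) = \sum_j hval (basis_class j) *~ v 0 j.
Proof.
rewrite -[LHS]/(\val (basis_map v)) /basis_map raddf_sum; apply: eq_bigr => j _.
by rewrite raddfMz.
Qed.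

(** The total exponent of the face Laurents along a chain. *)
Definition free_coord (z : chain1 al) : 'rV[int]_rk := \row_j coord (rshift nz j) z.

Lemma free_coord_is_zmod_morphism : zmod_morphism free_coord.
Proof. by move=> y z; apply/rowP => j; rewrite !mxE raddfB. Qed.
HB.instance Definition _ :=
  GRing.isZmodMorphism.Build (chain1 al) 'rV[int]_rk free_coord free_coord_is_zmod_morphism.

Lemma free_coord_dual f : free_coord (dual_edge f) = laurent P f.
Proof. by apply/rowP => j; rewrite mxE coord_dual. Qed.

Lemma basis_map_delta j : basis_map (delta_mx 0 j) = basis_class j.
Proof.
rewrite /basis_map (bigD1 j) //= mxE !eqxx mulr1z big1 ?addr0 // => k /negPf kj.
by rewrite mxE kj andbF mulr0z.
Qed.

Lemma free_coord_basis (j : 'I_rk) (z : chain1 al) :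
  (forall k, z (tri_row k) = invmx U k (rshift nz j)) -> free_coord z = delta_mx 0 j.
Proof.
move=> hz; apply/rowP => i; rewrite !mxE eqxx /=.
have <- : (U *m invmx U) (rshift nz i) (rshift nz j) = (i == j)%:R.
  by rewrite mulmxV ?fp_U_unit // mxE (inj_eq (@rshift_inj _ _)).
by rewrite mxE; apply: eq_bigr => k _; rewrite hz.
Qed.

(** In the expansion of z in the basis of cycles the first terms are torsion;
    the others are the basis classes of H, which do not depend on the chosen
    representing cycles because cycles are determined off the tree. *)
Lemma basis_map_free_coord z : bd z = 0 -> hval (basis_map (free_coord z)) = cls z.
Proof.
move=> bz; have [g hg] := choice (fun i => cycle_with_values (fun k => invmx U k i)).
rewrite {2}(cycle_expansion (fun i => (hg i).1) (fun i => (hg i).2) bz).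
rewrite big_split_ord raddfD !raddf_sum /= [X in X + _]big1 ?add0r => [|i _].
  rewrite hval_basis_map; apply: eq_bigr => j _; rewrite raddfMz /= mxE.
  congr (_ *~ _).
  have [y [by0 -> hy]] := basis_classP j; congr cls.
  apply/eqP; rewrite -subr_eq0; apply/eqP; apply: cycle_eq0.
    by rewrite raddfB /= by0 (hg _).1 subrr.
  by move=> k; rewrite !ffunE hy (hg _).2 subrr.
apply/eqP; rewrite cls_eq0 rpredMz //.
exact: (smith_torsion (hg _).1 (hg _).2).
Qed.

Lemma basis_map_bij : bijective basis_map.
Proof.
exists (fun h => free_coord (repr (hval h))) => [v|h].
  have bz h : bd (repr (hval h)) = 0 by apply/eqP; exact: hvalP.
  have clsK c : cls (repr c : chain1 al) = c by exact: reprK.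
  have inj u : basis_map u = 0 -> u = 0.
    have [y hy] := choice basis_classP.
    move=> /(congr1 (@hval _ al)) h.
    have : cls (\sum_j y j *~ u 0 j) = 0.
      rewrite -[RHS]h hval_basis_map raddf_sum /=; apply: eq_bigr => j _.
      by rewrite raddfMz /=; have [_ -> _] := hy j.
    move=> /eqP; rewrite cls_eq0 => ht.
    have <- : free_coord (\sum_j y j *~ u 0 j) = u.
      rewrite [RHS]row_sum_delta raddf_sum; apply: eq_bigr => j _.
      have [_ _ /free_coord_basis hj] := hy j.
      by rewrite raddfMz /= hj -scaler_int intz.
    by apply/rowP => j; rewrite !mxE coord_torsion.
  apply/eqP; rewrite -subr_eq0; apply/eqP; apply: inj.
  rewrite raddfB /=; apply/eqP; rewrite subr_eq0; apply/eqP.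
  by apply: val_inj; rewrite /= basis_map_free_coord // clsK.
have bz : bd (repr (hval h)) = 0 by apply/eqP; exact: hvalP.
by apply: val_inj; rewrite /= basis_map_free_coord //; exact: reprK.
Qed.

End Homology.

(** * Edges of the free abelian cover *)

Section Cover.
Variable V : veering.
Local Notation T := (tet V).
Local Notation al := (vcoor V).
Local Notation turn := (turn V).
Local Notation order := (fingraph.order turn).
Variables (t0 : T) (s : fund_domain al t0).
Implicit Types (x y : flag T) (u : ab_tet al t0).

(** How far n turns, starting from x, move the second component of a
    tetrahedron of the cover. *)
Definition holonomy n x : qchain al := \sum_(j < n) cls (flag_step al (iter j turn x)).

Lemma holonomyS n x : holonomy n.+1 x = holonomy n x + cls (flag_step al (iter n turn x)).
Proof. by rewrite /holonomy big_ord_recr. Qed.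

Lemma holonomyD m n x : holonomy (m + n) x = holonomy m x + holonomy n (iter m turn x).
Proof.
elim: n => [|n IH]; first by rewrite addn0 /holonomy big_ord0 addr0.
by rewrite addnS !holonomyS IH addrA -iterD addnC.
Qed.

Lemma holonomy_order x : holonomy (order x) x = 0.
Proof.
apply/eqP; rewrite /holonomy -raddf_sum -loop_orbit cls_eq0.
exact: loop_torsion.
Qed.

Lemma holonomy_closed n x : iter n turn x = x -> holonomy n x = 0.
Proof.
elim/ltn_ind: n => n IH hn; have [h|h] := ltnP n (order x).
  have := findex_iter h; rewrite hn findex0 => <-.
  by rewrite /holonomy big_ord0.
have h0 := fingraph.order_gt0 turn x.
move: hn; rewrite -(subnKC h) holonomyD holonomy_order add0r addnC iterD.
by rewrite iter_turn_order; apply: IH; lia.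
Qed.

Lemma holonomy_pred x :
  holonomy (order x).-1 x = - cls (flag_step al (iter (order x).-1 turn x)).
Proof.
apply/eqP; rewrite -addr_eq0 -holonomyS prednK ?fingraph.order_gt0 //.
by rewrite holonomy_order.
Qed.

Lemma iter_order_pred x : iter (order x).-1 turn x = unturn x.
Proof.
rewrite -[LHS](@turnK V) -iterS prednK ?fingraph.order_gt0 //.
by rewrite iter_turn_order.
Qed.

(** Every chain of identifications can be followed by forward turns only, since
    one backward turn equals a full turn less one, and a full turn has trivial
    holonomy. *)
Lemma same_edge_iter (z z' : ab_tet al t0 * medge) : same_edge (ab_cover al t0) z z' ->
  forall x, ((abval z.1).1, z.2) = emb x ->
  exists2 n, ((abval z'.1).1, z'.2) = emb (iter n turn x) &
    (abval z'.1).2 = (abval z.1).2 + holonomy n x.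
Proof.
elim=> {z z'} [[u A] z' /= [i hi ->] x [e1 e2]|[u A] x e|z1 z2 z3 _ IH1 _ IH2 x e].
- rewrite /= e1; move: hi; rewrite e2 => /notin_fedge [->|->].
    exists (order x).-1; first by rewrite iter_order_pred emb_unturn.
    rewrite holonomy_pred iter_order_pred /unturn flag_step_cross raddfN opprK.
    by rewrite /flag_step /= permM tpermR.
  by exists 1%N; rewrite /= ?emb_turn // holonomyS /holonomy big_ord0 add0r.
- by exists 0%N; rewrite //= /holonomy big_ord0 addr0.
have [n en hn] := IH1 x e; have [m em hm] := IH2 _ en.
exists (n + m)%N; first by rewrite addnC iterD.
by rewrite hm hn holonomyD addrA.
Qed.

Lemma iter_same_edge u x n : (abval u).1 = x.1 -> exists u',
  [/\ same_edge (ab_cover al t0) (u, fedge x) (u', fedge (iter n turn x)),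
      (abval u').1 = (iter n turn x).1 & (abval u').2 = (abval u).2 + holonomy n x].
Proof.
move=> e; elim: n => [|n [u' [IH1 IH2 IH3]]].
  by exists u; split=> //; [exact: rt_refl|rewrite /holonomy big_ord0 addr0].
set y := iter n turn x in IH1 IH2 IH3.
exists (ab_nbr u' (y.2 v3)); split.
- apply: (rt_trans _ _ _ _ _ IH1); apply: rt_step.
  exists (y.2 v3); first by case/andP: (fedge_notin y).
  rewrite /edge_across /= -/(turn y) IH2.
  by have /(congr1 snd) /= -> := emb_turn y.
- by rewrite /= IH2.
by rewrite /= IH3 IH2 holonomyS addrA.
Qed.

Lemma homology_of_lifts u u' : (abval u).1 = (abval u').1 ->
  exists h : homology al, hval h = (abval u').2 - (abval u).2.
Proof.
move=> e; have h : (abval u').2 - (abval u).2 \in @cycles _ al.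
  by rewrite unfold_in raddfB /= (eqP (abvalP u)) (eqP (abvalP u')) e subrr.
by exists (Homology h).
Qed.

(** Existence: completing the turn leads to the tetrahedron below the edge.
    Uniqueness: any other path there differs by full turns, because x is the
    only flag of its orbit at the top diagonal. *)
Lemma edge_coef_iter x n : at_top al x -> (n <= order x)%N ->
  let y := iter n turn x in
  hval (edge_coef s y.1 (fedge y)) =
    (abval (s y.1)).2 - (abval (s x.1)).2 - holonomy n x.
Proof.
move=> tx hn y.
have hol : holonomy (order x - n) y = - holonomy n x.
  apply/eqP; rewrite -addr_eq0 addrC -holonomyD subnKC //.
  by rewrite holonomy_order.
have yx : iter (order x - n) turn y = x by rewrite -iterD subnK // iter_turn_order.
have [u' [hu1 hu2 hu3]] := iter_same_edge (order x - n) (dom_over s y.1).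
rewrite yx in hu1 hu2; rewrite hol in hu3.
have [h hh] : exists h : homology al, hval h = (abval u').2 - (abval (s x.1)).2.
  by apply: homology_of_lifts; rewrite dom_over hu2.
have deckE : deck h (s x.1) = u'.
  apply: val_inj => /=; rewrite hh addrC subrK dom_over -hu2.
  by case: (abval u').
(* The coefficient is chosen by description, so it has to be characterised. *)
suff -> : edge_coef s y.1 (fedge y) = h by rewrite hh hu3 addrAC.
apply: xget_unique.
  by exists x.1; rewrite deckE -(eqP tx).
move=> h' [t' ht'].
have [m /= em hm] := same_edge_iter ht' (x := y) (congr1 (pair^~ _) (dom_over s y.1)).
move: em; rewrite dom_over => em.
have tz : at_top al (iter m turn y).
  have /= e1 := congr1 fst em; have /= e2 := congr1 snd em.
  by rewrite /at_top -e2 e1.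
have zx : iter m turn y = x.
  apply: (top_unique (@vtaut V) tx tz).
  by rewrite -fconnect_orbit -iterD fconnect_iter.
have ht : t' = x.1 by have /= := congr1 fst em; rewrite zx.
apply: val_inj; rewrite /= hh hu3; apply: (addrI (abval (s x.1)).2).
move: hm; rewrite ht => ->; rewrite [RHS]addrC subrK; congr (_ + _).
apply/eqP; rewrite -addr_eq0 addrC -holonomyD; apply/eqP; apply: holonomy_closed.
by rewrite addnC iterD.
Qed.

End Cover.

(** * Maps of group rings *)

Section Monomials.
Variable H : zmodType.

Lemma monD (h k : H) : mon (h + k) = mon h * mon k.
Proof. by rewrite -[RHS]/(gmul _ _) gmulUU mulr1. Qed.

Lemma mon0 : mon (0 : H) = 1.
Proof. by []. Qed.

Lemma mon_sum (I : Type) (r : seq I) (F : I -> H) :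
  \prod_(i <- r) mon (F i) = mon (\sum_(i <- r) F i).
Proof. by rewrite (big_morph (@mon H) monD mon0). Qed.

Lemma gring_sumE (g : gring H) :
  g = \sum_(k <- msupp (g : {malg int[H]})) mon k *~ mcoeff k g.
Proof.
rewrite {1}[g]monalgE; apply: eq_bigr => k _.
rewrite /mon; elim: (mcoeff k g) => [|n IH|n IH]; first by rewrite monalgU0.
  by rewrite intS mulrzDr mulr1z -IH -monalgUD.
by rewrite -addn1 PoszD opprD mulrzBr mulr1z -IH -monalgUB.
Qed.

End Monomials.

Section GroupRingMap.
Variables (G H : zmodType) (theta : {additive G -> H}).

Lemma gring_mapw (d : {fset G}) (g : gring G) :
  (msupp (g : {malg int[G]}) `<=` d)%fset ->
  gring_map theta g = \sum_(k <- d) mon (theta k) *~ mcoeff k g.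
Proof.
move=> le_d; rewrite /gring_map (big_fset_incl _ le_d) // => k _ /mcoeff_outdom ->.
by rewrite mulr0z.
Qed.

Lemma gring_map_is_zmod_morphism : zmod_morphism (gring_map theta : gring G -> gring H).
Proof.
move=> x y.
rewrite (gring_mapw (fsubsetUl (msupp (x : {malg int[G]})) (msupp (y : {malg int[G]})))).
rewrite (gring_mapw (fsubsetUr (msupp (x : {malg int[G]})) (msupp (y : {malg int[G]})))).
rewrite (gring_mapw (msuppB_le _ _)) -sumrB; apply: eq_bigr => k _.
by rewrite mcoeffB mulrzBr.
Qed.
HB.instance Definition _ := GRing.isZmodMorphism.Build (gring G) (gring H)
  (gring_map theta) gring_map_is_zmod_morphism.

Lemma gring_map_mon k : gring_map theta (mon k) = mon (theta k).
Proof.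
by rewrite (gring_mapw (d := [fset k]%fset)) ?msuppU_le // big_seq_fset1 mcoeffUU.
Qed.

Lemma gring_map_is_monoid_morphism : monoid_morphism (gring_map theta : gring G -> gring H).
Proof.
split; first by rewrite -mon0 gring_map_mon raddf0.
move=> x y; rewrite [x]gring_sumE [y]gring_sumE.
rewrite mulr_suml !raddf_sum /= mulr_suml; apply: eq_bigr => k _.
rewrite mulr_sumr !raddf_sum /= mulr_sumr; apply: eq_bigr => l _.
by rewrite !mulrzAl !mulrzAr -monD !raddfMz /= !gring_map_mon raddfD monD mulrzAl mulrzAr.
Qed.
HB.instance Definition _ := GRing.isMonoidMorphism.Build (gring G) (gring H)
  (gring_map theta) gring_map_is_monoid_morphism.

End GroupRingMap.

(** * Colours around a triangle *)

Section Colours.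
Variable V : veering.
Local Notation T := (tet V).
Local Notation al := (vcoor V).
Local Notation turn := (turn V).
Local Notation cross := (cross V).
Implicit Types x y z : flag T.

Definition is_red x := red (edge_of (emb x)).
Definition bot_red (t : T) := red (edge_of (t, bot_diag al t)).

Lemma swapE i j x k : (swap i j x).2 k = x.2 (tperm i j k).
Proof. exact: permM. Qed.

Lemma emb_eq x y : x.1 = y.1 -> [set x.2 v0; x.2 v1] = [set y.2 v0; y.2 v1] -> emb x = emb y.
Proof. by move=> e h; rewrite /emb e; congr pair; apply: medge_inj. Qed.

Lemma slope x : ~~ odd_perm x.2 -> at_top al x ->
  is_red (swap v1 v2 x) /\ ~~ is_red (swap v0 v2 x).
Proof.
case: x => t p /= ev /eqP tx.
have [c02 _ _ c12] := red_slope ev tx.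
split; rewrite /is_red.
  by apply: c02; rewrite /= !permM !permE.
by apply/negbT; apply: c12; rewrite /= !permM !permE /= finset.setUC.
Qed.

Lemma is_red_cross x : is_red (cross x) = is_red x.
Proof. by rewrite /is_red -(edge_of_turn x) emb_swap23. Qed.

Lemma is_red_swap01 x : is_red (swap v0 v1 x) = is_red x.
Proof. by rewrite /is_red emb_swap01. Qed.

Lemma out_cross3 x : out al (cross x) v3 = ~~ out al x v3.
Proof. by rewrite /out /= permM outward_glue. Qed.

Lemma bot_redE x : at_bot al x -> bot_red x.1 = is_red x.
Proof. by move=> /eqP e; rewrite /bot_red -e. Qed.

(** Let p, q, r be the vertices 0, 1, 2 of y. From below, pq is the top
    diagonal, pr is red and qr is blue. The three cases are the position of the
    bottom diagonal of the tetrahedron above: if it is pq, then qr would have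
    to be red; if it is pr, then pq is red like pr; if it is qr, then pq is
    blue like qr. *)
Lemma face_colours_even y : ~~ odd_perm y.2 -> at_top al y ->
  let z := cross y in
  [/\ out al z v2, out al z v0 = ~~ out al z v1, is_red y = bot_red z.1,
    out al z v1 -> is_red (swap v1 v2 y) = ~~ bot_red z.1 &
    out al z v0 -> is_red (swap v0 v2 y) = ~~ bot_red z.1].
Proof.
move=> ev ty z.
have [r02 r12] := slope ev ty.
have z3 : out al z v3 = false.
  by rewrite out_cross3; move: ty; rewrite at_topP => /andP [_ ->].
have oz : odd_perm z.2 by rewrite odd_cross.
rewrite -is_red_cross cross_swap // -/z in r02.
rewrite -is_red_cross cross_swap // -/z in r12.
rewrite -(is_red_cross (swap v1 v2 y)) -(is_red_cross (swap v0 v2 y)).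
rewrite -(is_red_cross y) !cross_swap // -/z.
clearbody z; have := outward_sum al z; rewrite z3.
case z0 : (out al z v0); case z1 : (out al z v1); case z2 : (out al z v2) => // _.
(* In each case x is an even labelling of the tetrahedron above that puts its
   top diagonal first, as needed to read off the colours. *)
- pose x := swap v2 v3 (swap v1 v3 (swap v0 v2 z)).
  have ex : ~~ odd_perm x.2 by rewrite !odd_swap // oz.
  have tx : at_top al x.
    by rewrite at_topP /out /= !permM !permE /= -/(out al z v0) -/(out al z v1) z0 z1.
  have [r _] := slope ex tx; case/negP: r12.
  rewrite (_ : is_red _ = is_red (swap v1 v2 x)) //.
  rewrite /is_red; congr (red (edge_of _)); apply: emb_eq => //.
  by rewrite /= !permM !permE /= finset.setUC.
- have b : at_bot al (swap v1 v2 z).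
    by rewrite at_botP /out /= !permM !permE /= -/(out al z v1) -/(out al z v3) z1 z3.
  rewrite (bot_redE b) r02 (negPf r12).
  pose x := reverse (swap v0 v3 z).
  have ex : ~~ odd_perm x.2 by rewrite !odd_swap // oz.
  have tx : at_top al x.
    by rewrite at_topP /out /= !permM !permE /= -/(out al z v0) -/(out al z v2) z0 z2.
  have [r _] := slope ex tx; split => //.
  rewrite -r /is_red; congr (red (edge_of _)); apply: emb_eq => //.
  by rewrite /= !permM !permE /= finset.setUC.
have b : at_bot al (swap v0 v2 z).
  by rewrite at_botP /out /= !permM !permE /= -/(out al z v0) -/(out al z v3) z0 z3.
rewrite (bot_redE b) r02 (negPf r12).
pose x := reverse (swap v1 v3 z).
have ex : ~~ odd_perm x.2 by rewrite !odd_swap // oz.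
have tx : at_top al x.
  by rewrite at_topP /out /= !permM !permE /= -/(out al z v1) -/(out al z v2) z1 z2.
have [_ r] := slope ex tx; split => //.
rewrite -(negPf r) /is_red; congr (red (edge_of _)); apply: emb_eq => //.
by rewrite /= !permM !permE /= finset.setUC.
Qed.

(** Both labellings of the top diagonal are covered by exchanging its ends. *)
Lemma face_colours y : at_top al y ->
  let z := cross y in
  [/\ out al z v2, is_red y = bot_red z.1,
    out al z v1 -> is_red (swap v1 v2 y) = ~~ bot_red z.1 &
    out al z v0 -> is_red (swap v0 v2 y) = ~~ bot_red z.1].
Proof.
move=> ty z; have [ev|od] := boolP (odd_perm y.2); last first.
  by have [? _ ? ? ?] := face_colours_even od ty.
have ty' : at_top al (swap v0 v1 y) by rewrite /at_top fedge_swap01.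
have od : ~~ odd_perm (swap v0 v1 y).2 by rewrite odd_swap // negbK.
have [h2 _ h h1 h0] := face_colours_even od ty'.
have e : cross (swap v0 v1 y) = swap v0 v1 z by exact: cross_swap.
move: h2 h h1 h0; rewrite e is_red_swap01 => h2 h h1 h0.
have o k : out al (swap v0 v1 z) k = out al z (tperm v0 v1 k) by rewrite /out swapE.
rewrite !o !tperm_values /= in h2 h1 h0.
split=> //.
  move=> /h0 <-; congr (red (edge_of _)); apply: emb_eq => //.
  by rewrite /= !permM !permE /= finset.setUC.
move=> /h1 <-; congr (red (edge_of _)); apply: emb_eq => //.
by rewrite /= !permM !permE /= finset.setUC.
Qed.

Lemma bottom_colour_top y : at_top al y ->
  is_red (turn y) = bot_red (turn y).1.
Proof.
move=> ty; have [_ <- _ _] := face_colours ty.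
by rewrite /is_red edge_of_turn.
Qed.

(** Here the edge is equatorial on both sides of the triangle, so it is the
    third edge, different from both diagonals. *)
Lemma bottom_colour_side y : out al y v3 -> ~~ at_top al y -> ~~ at_bot al (turn y) ->
  is_red (turn y) = ~~ bot_red (turn y).1.
Proof.
rewrite at_topP => o3; rewrite o3 andbT => o2.
rewrite {1}/turn at_bot_swap23 at_botP out_cross3 o3 andbT negbK => oz.
suff h x : out al x v3 -> ~~ out al x v2 -> ~~ out al x v0 -> out al (cross x) v2 ->
    is_red (turn x) = ~~ bot_red (turn x).1.
  have := outward_sum al y; rewrite o3 (negPf o2).
  case y0 : (out al y v0); case y1 : (out al y v1) => // _; last first.
    by apply: h; rewrite ?y0.
  rewrite -is_red_swap01 -[X in bot_red X]/((swap v0 v1 (turn y)).1) -turn_swap01.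
  apply: (h (swap v0 v1 y)).
  - by rewrite /out /= permM tpermD.
  - by rewrite /out /= permM tpermD.
  - by rewrite /out /= permM tpermL -/(out al y v1) y1.
  by rewrite cross_swap // /out /= permM tpermD.
move=> {y o2 o3 oz} o3 o2 o0 oz.
have ty : at_top al (swap v1 v2 x).
  have := outward_sum al x; rewrite o3 (negPf o2) (negPf o0).
  rewrite at_topP /out /= !permM !permE /= -/(out al x v1) -/(out al x v3) o3.
  by case: (out al x v1).
have [_ _ h _] := face_colours ty; move: h; rewrite swapK cross_swap //.
by rewrite {1}/out /= permM tpermL /is_red edge_of_turn => ->.
Qed.

End Colours.

(** * Comparison of the two matrices *)

Section Determinants.
Variables (R : comNzRingType) (T : finType).

Lemma det_reindex (F : T -> T -> R) n (f g : 'I_n -> T) : bijective f -> bijective g ->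
  \det (\matrix_(i < n, j < n) F (f i) (f j)) = \det (\matrix_(i < n, j < n) F (g i) (g j)).
Proof.
move=> fb [g' gK g'K].
have inj : injective (g' \o f) by apply: inj_comp (bij_inj fb); exact: can_inj g'K.
pose u := perm inj.
have -> : \matrix_(i < n, j < n) F (f i) (f j) =
    row_perm u (col_perm u (\matrix_(i < n, j < n) F (g i) (g j))).
  by apply/matrixP => i j; rewrite !mxE !permE /= !g'K.
rewrite row_permE col_permE !det_mulmx !det_perm odd_permV mulrCA mulrA.
by rewrite -[RHS]mulr1 -mulrA -signr_addb addbb.
Qed.

Lemma det_conj_diag n (A B : 'M[R]_n) (a b : 'I_n -> R) :
  (forall i, a i * b i = 1) -> (forall i j, B i j = b j * a i * A i j) -> \det B = \det A.
Proof.
move=> ab hB.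
have -> : B = diag_mx (\row_i a i) *m A *m diag_mx (\row_i b i).
  apply/matrixP => i j; rewrite hB mul_mx_diag mul_diag_mx !mxE.
  by rewrite -mulrA mulrC.
rewrite !det_mulmx !det_diag mulrAC -big_split /= big1 ?mul1r // => i _.
by rewrite !mxE.
Qed.

End Determinants.

Lemma signed_sum (Z : zmodType) (I : finType) (F : I -> Z) (P : pred I) (a b : I) :
  a != b ->
  F a - F b - \sum_(i | [&& i != a, i != b & P i]) F i =
  \sum_i F i *~ (if i == a then 1 else if i == b then -1 else - (P i)%:Z).
Proof.
move=> ab; rewrite [RHS](bigD1 a) //= [X in _ = _ + X](bigD1 b) /=; last by rewrite eq_sym.
rewrite eqxx eq_sym (negPf ab) eqxx mulr1z mulrN1z addrA; congr (_ + _).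
rewrite -sumrN [LHS]big_mkcond [RHS]big_mkcond; apply: eq_bigr => i _.
case: (i == a) => //=; case: (i == b) => //=.
by case: (P i); rewrite ?mulrN1z ?oppr0 ?mulr0z.
Qed.

Lemma sum_nat_reflect (Z : zmodType) (F G : nat -> Z) k k' d :
  k' = (d - k)%N -> (forall i, 0 < i < k' -> F (d - i) = G i)%N ->
  \sum_(k.+1 <= i < d) F i = \sum_(1 <= i < k') G i.
Proof.
move=> -> h; rewrite big_nat_rev -{1}[k.+1]add1n big_addn big_nat [RHS]big_nat.
apply: eq_bigr => i hi; rewrite -h //; congr F; lia.
Qed.

Lemma scaled_signed_sum (R S : comNzRingType) (g : {additive R -> S}) (c : S) (a b p q : R)
    (s0 s1 s2 s3 : S) :
  s0 = (c * g a) *~ 1 -> s1 = - (c * g q) -> s2 = (c * g b) *~ -1 -> s3 = - (c * g p) ->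
  s0 + s1 + (s2 + s3) = c * g (a - b - p - q).
Proof.
move=> -> -> -> ->; rewrite !raddfB /= !mulrBr mulr1z mulrN1z.
by rewrite addrACA addrA addrAC.
Qed.

Lemma subD_congr (Z : zmodType) (a a' b b' c d : Z) :
  a = a' -> b = b' -> a - b - (c + d) = a' - b' - c - d.
Proof. by move=> -> ->; rewrite opprD addrA. Qed.

Section Matching.
Variables (V : veering) (w : edge_view V) (P : face_pairings w).
Local Notation T := (tet V).
Local Notation al := (vcoor V).
Local Notation turn := (turn V).
Local Notation order := (fingraph.order turn).
Local Notation orbit := (fingraph.orbit turn).
Local Notation Theta := (@basis_map V w P).
Local Notation freec := (@free_coord V w P).
Variables (t0 : T) (s : fund_domain al t0).
Implicit Types (x y : flag T) (t : T).

Lemma bd_steps n x :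
  bd (\sum_(j < n) flag_step al (iter j turn x)) = pt (iter n turn x).1 - pt x.1.
Proof.
elim: n => [|n IH]; first by rewrite big_ord0 raddf0 subrr.
rewrite big_ord_recr raddfD /= IH bd_step -/(turn _).
by rewrite addrC telescope_sub.
Qed.

(** The discrepancy between the lift of t in the fundamental domain and the
    lift for which the face Laurents would give the exact coefficients. *)
Definition lift_class t : homology al := Theta (freec (repr (abval (s t)).2)).

Lemma edge_coef_laurent x n : at_top al x -> (n <= height al x)%N ->
  let y := iter n turn x in
  edge_coef s y.1 (fedge y) =
    lift_class y.1 - lift_class x.1 + Theta (\sum_(f <- take n (side_faces al x)) - laurent P f).
Proof.
move=> tx hn y.
have clsK c : cls (repr c : chain1 al) = c by exact: reprK.
pose z : chain1 al := repr (abval (s y.1)).2 - repr (abval (s x.1)).2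
  - \sum_(j < n) flag_step al (iter j turn x).
have bdr t : bd (repr (abval (s t)).2) = pt t - pt t0.
  by have := abvalP (s t); rewrite dom_over => /eqP.
have bz : bd z = 0.
  by rewrite /z !raddfB /= !bdr bd_steps !opprB !telescope_sub subrr.
have -> : lift_class y.1 - lift_class x.1 +
    Theta (\sum_(f <- take n (side_faces al x)) - laurent P f)
    = Theta (freec z).
  rewrite /lift_class /z !raddfB /=; congr (_ + _).
  rewrite -(sum_take_side (@vtaut V)) // (raddf_sum freec) sumrN raddfN; congr (- Theta _).
  by apply: eq_bigr => f _; rewrite /= free_coord_dual.
apply: val_inj; rewrite /= basis_map_free_coord // edge_coef_iter //; last first.
  exact: leq_trans hn (ltnW (height_lt tx)).
by rewrite /z !raddfB /= !clsK (raddf_sum (@cls _ al)).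
Qed.

Local Notation LR := (gring 'rV[int]_(fp_rk P)).
Local Notation gmap := (gring_map Theta).

(** The coefficient with which an embedded edge enters the image of its
    tetrahedron, up to a monomial. *)
Definition weight (z : T * medge) : int :=
  if z.2 == top_diag al z.1 then 1 else
  if z.2 == bot_diag al z.1 then -1 else
  - (red (edge_of z) != bot_red z.1)%:Z.

Definition contribution t (z : T * medge) : gring (homology al) :=
  if z.1 == t then mon (edge_coef s z.1 z.2) *~ weight z else 0.

Lemma top_neq_bot t : top_diag al t != bot_diag al t.
Proof.
apply/eqP => /(congr1 val) /= /setP /(_ v0); rewrite !inE.
by case: outward.
Qed.

Lemma lower_map_sum e t :
  lower_map s e t = \sum_(z | edge_of z == e) contribution t z.
Proof.
transitivity (\sum_(A : medge) lift_edge s t A e *~ weight (t, A)).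
  exact: (signed_sum (fun A => lift_edge s t A e) _ (top_neq_bot t)).
rewrite /contribution -big_mkcondr /=.
rewrite (reindex_onto (fun A => (t, A)) snd) /=; last by case=> t' A /= /andP [_ /eqP ->].
rewrite [RHS](eq_bigl (fun A => edge_of (t, A) == e)); last first.
  by move=> A /=; rewrite !eqxx !andbT.
rewrite [RHS]big_mkcond /=; apply: eq_bigr => A _; rewrite /lift_edge.
by case: eqP => // _; rewrite mul0rz.
Qed.

Definition side_term x t n : LR :=
  if (iter n turn x).1 == t then inv_laurents P (take n (side_faces al x)) else 0.

Lemma contribution_side_term x t n : at_top al x -> (n <= height al x)%N ->
  contribution t (emb (iter n turn x)) =
    (mon (lift_class t) * mon (- lift_class x.1) * gmap (side_term x t n)) *~
      weight (emb (iter n turn x)).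
Proof.
move=> tx hn; rewrite /contribution /side_term /=; case: eqP => [<-|_]; last first.
  by rewrite raddf0 mulr0 mul0rz.
rewrite edge_coef_laurent // /inv_laurents mon_sum gring_map_mon.
by rewrite !monD.
Qed.

Lemma weight_emb x : weight (emb x) =
  if at_top al x then 1 else if at_bot al x then -1 else - (is_red x != bot_red x.1)%:Z.
Proof. by []. Qed.

(** The edge is the top diagonal below the first triangle of the side, and the
    third edge of all later triangles except the last. *)
Lemma weight_side x i : at_top al x -> (0 < i < height al x)%N ->
  weight (emb (iter i turn x)) = - (1 < i)%:Z.
Proof.
move=> tx /andP [i0 ik]; have id := ltn_trans ik (height_lt tx).
have tb := top_bot_count (@vtaut V) tx.
rewrite weight_emb !tb // gtn_eqF // ltn_eqF //.
case: i i0 ik id => // -[|i] _ ik id /=.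
  by rewrite bottom_colour_top // eqxx.
have idd := ltnW id.
rewrite (@bottom_colour_side _ (turn (iter i turn x))); first by case: bot_red.
- by rewrite -iterS (out_iter (@vtaut V)) // ltnW.
- by rewrite -iterS tb.
by rewrite -!iterS tb // ltn_eqF.
Qed.

Lemma side_contribution x t : at_top al x ->
  \sum_(1 <= i < height al x) contribution t (emb (iter i turn x)) =
  - (mon (lift_class t) * mon (- lift_class x.1) *
     gmap (\sum_(1 <= i < (height al x).-1) side_term x t i.+1)).
Proof.
move=> tx; have k0 := height_gt0 tx.
rewrite (raddf_sum gmap) mulr_sumr -sumrN /=.
have [->|k1] := eqVneq (height al x) 1%N; first by rewrite !big_geq.
rewrite big_ltn; last by lia.
rewrite contribution_side_term // weight_side //; last by lia.
rewrite oppr0 mulr0z add0r -{1}(prednK k0) big_add1 /=.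
rewrite big_nat [RHS]big_nat; apply: eq_bigr => i /andP [hi1 hi2].
rewrite (@contribution_side_term x t i.+1) ?weight_side //; try lia.
by rewrite ltnS hi1 mulrN1z.
Qed.

Lemma lvp_entryE e t : let x := w e in let x' := swap v2 v3 x in
  lvp_entry P e t = side_term x' t 0 - side_term x' t (height al x')
    - \sum_(1 <= i < (height al x').-1) side_term x' t i.+1
    - \sum_(1 <= i < (height al x).-1) side_term x t i.+1.
Proof.
move=> x x'; have tx : at_top al x := at_top_view w e.
have tx' : at_top al x' by rewrite at_top_swap23.
have above_face y : out al y v3 -> above (flag_face al y) = (turn y).1.
  by move=> o; rewrite /above /flag_face /= /side_below /= ifT.
have above_nth f0 y i : at_top al y -> (i < height al y)%N ->
    above (nth f0 (side_faces al y) i) = (iter i.+1 turn y).1.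
  move=> ty hi; rewrite nth_side_faces // above_face //.
  by rewrite (out_iter (@vtaut V)) // (ltn_trans hi (height_lt ty)).
have sum_side f0 y : at_top al y ->
    \sum_(1 <= i < (size (side_faces al y)).-1)
      (if above (nth f0 (side_faces al y) i) == t
       then inv_laurents P (take i.+1 (side_faces al y)) else 0)
    = \sum_(1 <= i < (height al y).-1) side_term y t i.+1.
  move=> ty; rewrite size_side_faces // big_nat [RHS]big_nat.
  by apply: eq_bigr => i /andP [_ hi]; rewrite above_nth //; lia.
have eL : left_side w e = side_faces al x' by [].
have eR : right_side w e = side_faces al x by [].
rewrite /lvp_entry eL eR; set f0 := face_of _ _.
rewrite big_cons big_seq1.
rewrite (sum_side f0 x tx) (sum_side f0 x' tx').
apply: subD_congr.
  rewrite -nth0 nth_side_faces ?height_gt0 // /side_term take0 /inv_laurents big_nil.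
  have /andP [_ o] : out al x' v2 && out al x' v3 by rewrite -at_topP.
  rewrite /below /flag_face /= /side_below /= ifT //=.
  by case: eqP.
rewrite -nth_last above_nth ?size_side_faces // prednK ?height_gt0 //.
by rewrite /side_term -{3}(size_side_faces tx') take_size.
Qed.

(** Walking once around e, starting below it: its top-diagonal embedding, the
    right side upwards, its bottom-diagonal embedding, the left side downwards.
    The two diagonal embeddings are attributed to the left side, as in the
    algorithm. *)
Lemma lower_map_entry e t :
  lower_map s e t =
    mon (lift_class t) * mon (- lift_class (w e).1) * gmap (lvp_entry P e t).
Proof.
set x := w e; have tx : at_top al x := at_top_view w e.
set x' := swap v2 v3 x.
have tx' : at_top al x' by rewrite at_top_swap23.
have ee : edge_of (emb x) = e by exact: view_edge.
rewrite lower_map_sum -{1}ee big_edge (big_nth x) size_orbit.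
rewrite (eq_big_nat _ _ (F2 := fun i => contribution t (emb (iter i turn x)))); last first.
  by move=> i /andP [_ hi]; rewrite nth_orbit.
have hk := height_lt tx; have k0 := height_gt0 tx.
rewrite (@big_cat_nat _ _ _ (height al x)) ?(ltnW hk) //=.
rewrite big_ltn // [X in _ + _ + X]big_ltn //.
have hk' : height al x' = (order x - height al x)%N by rewrite (height_swap23 (@vtaut V)).
have flip i : (i <= order x)%N -> emb (iter i turn x) = emb (iter (order x - i) turn x').
  by move=> hi; rewrite iter_turn_swap23_sub ?leq_subr // subKn // emb_swap23.
have -> : \sum_((height al x).+1 <= i < order x) contribution t (emb (iter i turn x))
   = \sum_(1 <= i < height al x') contribution t (emb (iter i turn x')).
  apply: (sum_nat_reflect hk') => i /andP [_ hi].
  by rewrite flip; [congr (contribution t (emb (iter _ turn x'))); lia | lia].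
have W0 : weight (emb (iter 0 turn x')) = 1 by rewrite weight_emb /= tx'.
have Wk : weight (emb (iter (height al x') turn x')) = -1.
  have nt : at_top al (iter (height al x') turn x') = false.
    by rewrite (top_bot_count (@vtaut V) tx' (height_lt tx')) gtn_eqF // height_gt0.
  by rewrite weight_emb nt at_bot_height.
rewrite lvp_entryE; apply: scaled_signed_sum.
- rewrite -W0 -[emb x](emb_swap23 x).
  exact: (contribution_side_term t tx' (leq0n _)).
- exact: side_contribution.
- rewrite -Wk (flip _ (ltnW hk)) -hk'.
  exact: (contribution_side_term t tx' (leqnn _)).
exact: (side_contribution t tx').
Qed.

End Matching.

(** By uniqueness of the tetrahedron immediately below an edge. *)
Lemma view_of_top (V : veering) (w : edge_view V) t :
  (w (edge_of (t, top_diag (vcoor V) t))).1 = t.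
Proof.
set e := edge_of _; have := eqxx e; rewrite -{2}(view_edge w e) edge_of_orbit.
rewrite edge_class_emb => /imsetP [y hy ey].
have /= e1 := congr1 fst ey; have /= e2 := congr1 snd ey.
have ty : at_top (vcoor V) y by rewrite /at_top -e2 e1.
by rewrite e1 (top_unique (@vtaut V) (at_top_view w e) ty hy).
Qed.

Theorem proposition6p6 (V : veering) (run : lvp_run V) :
  exists theta : {additive 'rV[int]_(fp_rk (run_fp run)) -> homology (vcoor V)},
    [/\ bijective theta,
        forall j : 'I_(fp_rk (run_fp run)),
          is_basis_class j (theta (delta_mx 0 j)) &
        forall (t0 : tet V) (s : fund_domain (vcoor V) t0),
          gring_map theta (lvp_output run) = lower_veering_polynomial s].
Proof.
set P := run_fp run.
exists (@basis_map V (run_view run) P); split; first exact: basis_map_bij.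
  by move=> j; rewrite /= basis_map_delta; exact: basis_classP.
move=> t0 s; pose top t := edge_of (t, top_diag (vcoor V) t).
pose F t' t := gring_map (@basis_map V (run_view run) P) (lvp_entry P (top t') t).
transitivity (\det (\matrix_(i < #|tet V|, j < #|tet V|) F (run_T run i) (run_T run j))).
  rewrite /lvp_output -det_map_mx; congr determinant.
  by apply/matrixP => i j; rewrite !mxE run_top.
rewrite (det_reindex F (run_T_bij run) (@enum_val_bij (tet V))).
symmetry; apply: (det_conj_diag (a := fun i => mon (- lift_class P s (enum_val i)))
  (b := fun i => mon (lift_class P s (enum_val i)))) => [i|i j].
  by rewrite -monD addNr.
by rewrite !mxE (lower_map_entry P s) view_of_top.
Qed.
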